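(* Let $c\in[c_0,c_1]$, let $u$ be the entropy solution of $u_t+H(x,t,c+u)_x=0$ in $\mathbb T\times(0,T]$ with $u(\cdot,0)=u^0\in L^\infty_{r,0}(\mathbb T)$, and let $u_\Delta$ be given by the Lax-Friedrichs difference solution with the same $c$ and $u^0$, where $\Delta=(\Delta x,\Delta t)$ satisfies the mesh conditions listed in the context. Then (with constants $\beta_4(t),\beta_5,\beta_6$ independent of $\Delta$): 1. For any $T\in(0,\infty)$ and each $t\in(0,T]$ there exists a constant $\beta_4(t)>0$, independent of the initial data $u^0$, for which $$\|u_\Delta(\cdot,t)-u(\cdot,t)\|_{L^1(\mathbb T)}\le\beta_4(t)\,\Delta x^{\frac14}.$$ In particular, if $u^0$ is rarefaction-free, then there exists a constant $\beta_5>0$ for which $$\sup_{0\le t\le T}\|u_\Delta(\cdot,t)-u(\cdot,t)\|_{L^1(\mathbb T)}\le\beta_5\,\Delta x^{\frac14}.$$ 2. If $u$ is Lipschitz in $\mathbb T\times[0,T]$, then there exists a constant $\beta_6>0$ for which $$\sup_{(x,t)\in\mathbb T\times[0,T]}|u_\Delta(x,t)-u(x,t)|\le\beta_6\,\Delta x^{\frac14}.$$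
   Context: $\mathbb T=\mathbb R/\mathbb Z$. $H=H(x,t,p):\mathbb T^2\times\mathbb R\to\mathbb R$ satisfies: (A1) $H$ is $C^2$; (A2) $H_{pp}>0$; (A3) $\lim_{|p|\to\infty}H(x,t,p)/|p|=+\infty$; (A4) the Legendre transform $L(x,t,\xi)=\sup_p\{\xi p-H(x,t,p)\}$ satisfies $|L_x|\le\alpha(|L|+1)$ for some $\alpha>0$. Put $L^{(c)}(x,t,\xi)=L(x,t,\xi)-c\xi$. Numbers $T,r>0$ and $c_0\le c_1$ are arbitrarily fixed; $h$ is a continuous function of $c$. $L^\infty_{r,0}(\mathbb T)$: all $u^0\in L^\infty(\mathbb T)$ with $\|u^0\|_{L^\infty}\le r$, $\int_{\mathbb T}u^0dx=0$. If $v^0$ is a primitive of $u^0$ and $v$ is the viscosity solution of $v_t+H(x,t,c+v_x)=h(c)$, $v(\cdot,0)=v^0$, then the entropy solution is $u=v_x$, and this representative of $u$ is always used; $(x,t)$ is regular if $v_x(x,t)$ exists. $u^0$ is rarefaction-free if $\operatorname{ess\,sup}_{x\ne y}\frac{u^0(x)-u^0(y)}{x-y}\le M$ for some $M>0$. Mesh: $N\le K$ natural numbers, $\Delta x=(2N)^{-1}$, $\Delta t=(2K)^{-1}$, $\lambda=\Delta t/\Delta x$, $x_m=m\Delta x$, $t_k=k\Delta t$; $k(t)$ is the integer $k$ with $t\in[t_k,t_{k+1})$. Scheme: $u^k_m$ ($m+k$ even) satisfies $$\frac{u^{k+1}_{m+1}-\frac{u^k_m+u^k_{m+2}}2}{\Delta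 t}+\frac{H(x_{m+2},t_k,c+u^k_{m+2})-H(x_m,t_k,c+u^k_m)}{2\Delta x}=0,\quad u^k_{m\pm2N}=u^k_m,$$ $u^0_m=\frac1{2\Delta x}\int_{x_m-\Delta x}^{x_m+\Delta x}u^0dy$ ($m$ even); $u_\Delta(x,t)=u^k_m$ on $[x_{m-1},x_{m+1})\times[t_k,t_{k+1})$. Also $v^k_m$ ($m+k$ odd, $2N$-periodic in $m$) solves $\frac{v^{k+1}_m-(v^k_{m-1}+v^k_{m+1})/2}{\Delta t}+H(x_m,t_k,c+\frac{v^k_{m+1}-v^k_{m-1}}{2\Delta x})=h(c)$, $v^0_{m+1}=v^0(x_{m+1})$, so that $u^k_m=\frac{v^k_{m+1}-v^k_{m-1}}{2\Delta x}$, and $v_\Delta$ is its piecewise linear interpolation in $x$ on each $[t_k,t_{k+1})$. Constant $\lambda_1$ (from earlier work of Soga): there are $\lambda_1>0$, $\delta_0>0$, depending on $T,[c_0,c_1],r$ (and $H$), such that for every mesh with $\lambda<\lambda_1$, $\Delta x\le\delta_0$, every $c\in[c_0,c_1]$ and $u^0\in L^\infty_{r,0}(\mathbb T)$, $|H_p(x_m,t_k,c+u^k_m)|\le\lambda_1^{-1}<\lambda^{-1}$ for $0\le k<k(T)$; and, for $\Delta\to0$ with $0<\lambda_0\le\lambda<\lambda_1$ ($\lambda_0$ fixed), $\sup_{t\in[0,T]}\|v_\Delta(\cdot,t)-v(\cdot,t)\|_{C^0}\le\beta_2\sqrt{\Delta x}$ with $\beta_2$ independent of $\Delta$, $c$ and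 the initial data, and $u_\Delta(x,t)\to u(x,t)$ at each regular point. Notation: $u^*=\sup_{x,t\in\mathbb T,\,c\in[c_0,c_1],\,|\xi|\le\lambda_1^{-1}}|L^{(c)}_\xi(x,t,\xi)|$; $H^*_{xx}$ and $H^*_{xp}$ are the suprema of $|H_{xx}(x,t,c+u)|$ and $|H_{xp}(x,t,c+u)|$, and $H^*_{pp}>0$ is the infimum of $|H_{pp}(x,t,c+u)|$, over $x,t\in\mathbb T$, $c\in[c_0,c_1]$, $|u|\le u^*$; $\eta=\max\{2H^*_{xp}+H^*_{pp},\ \tfrac12H^*_{pp}+H^*_{xx}\}$; $E^*=\frac{2H^*_{xp}}{H^*_{pp}}+\sqrt{4\big(\frac{H^*_{xp}}{H^*_{pp}}\big)^2+\frac{2H^*_{xx}}{H^*_{pp}}}$. Mesh conditions on $\Delta$: $0<\lambda_0\le\lambda<\lambda_1$, $\Delta x\le\delta_0$, $\Delta t<\min\{(2\eta)^{-1},(E^*H^*_{pp}+2H^*_{xp})^{-1}\}$, and $$\sup_{x,t\in\mathbb T,\,c\in[c_0,c_1],\,|u|\le u^*}\lambda\big(|H_p(x,t,c+u)|+H^*_{xp}\cdot2\Delta x\big)<1,\qquad\lambda\le\frac{1-2H^*_{xp}\Delta t}{rH^*_{pp}+(1+H^*_{pp})\Delta x}.$$ *)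

(* Defs.v *)
From mathcomp Require Import all_boot all_order all_algebra.
From mathcomp Require Import all_classical all_reals all_analysis.
From mathcomp Require Import ess_sup_inf.

Set Implicit Arguments.
Unset Strict Implicit.
Unset Printing Implicit Defensive.

Import Order.TTheory GRing.Theory Num.Theory.
Import numFieldNormedType.Exports.

Local Open Scope classical_set_scope.
Local Open Scope ring_scope.

(* Functions on the torus R/Z are 1-periodic functions on R. *)

Definition periodic1 (R : realType) (A : Type) (f : R -> A) : Prop :=
  forall x, f (x + 1) = f x.

Definition Dx (R : realType) (F : R -> R -> R -> R) (x t p : R) : R :=
  derive1 (fun y => F y t p) x.

Definition Dt (R : realType) (F : R -> R -> R -> R) (x t p : R) : R :=
  derive1 (fun s => F x s p) t.

Definition Dp (R : realType) (F : R -> R -> R -> R) (x t p : R) : R :=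
  derive1 (fun q => F x t q) p.

Definition jointly_continuous (R : realType) (F : R -> R -> R -> R) : Prop :=
  continuous (fun z : R * R * R => F z.1.1 z.1.2 z.2).

Definition C1_3 (R : realType) (F : R -> R -> R -> R) : Prop :=
  [/\ forall x t p, [/\ derivable (fun y => F y t p) x 1,
        derivable (fun s => F x s p) t 1 & derivable (fun q => F x t q) p 1],
      jointly_continuous (Dx F), jointly_continuous (Dt F)
    & jointly_continuous (Dp F)].

Definition C2_3 (R : realType) (F : R -> R -> R -> R) : Prop :=
  [/\ C1_3 F, C1_3 (Dx F), C1_3 (Dt F) & C1_3 (Dp F)].

Definition legendre (R : realType) (H : R -> R -> R -> R) (x t xi : R) : R :=
  sup [set xi * p - H x t p | p in [set: R]].

Definition Lc (R : realType) (H : R -> R -> R -> R) (c x t xi : R) : R :=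
  legendre H x t xi - c * xi.

Record hamiltonian (R : realType) (H : R -> R -> R -> R) : Prop := {
  ham_per_x : periodic1 H;
  ham_per_t : forall x, periodic1 (H x);
  ham_C2 : C2_3 H;
  ham_convex : forall x t p, 0 < Dp (Dp H) x t p;
  ham_superlinear_pos : forall x t, H x t p / `|p| @[p --> +oo] --> +oo;
  ham_superlinear_neg : forall x t, H x t p / `|p| @[p --> -oo] --> +oo;
  ham_Lx : exists2 alpha : R, 0 < alpha &
    forall x t xi,
      `|Dx (legendre H) x t xi| <= alpha * (`|legendre H x t xi| + 1) }.

(* L^oo_{r,0}; by periodicity the essential supremum over R is the one over
   the torus. *)
Definition Linf_r0 (R : realType) (r : R) (u0 : R -> R) : Prop :=
  [/\ periodic1 u0, measurable_fun [set: R] u0,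
      ('N[lebesgue_measure]_+oo[EFin \o u0] <= r%:E)%E
    & \int[lebesgue_measure]_(x in `[0, 1]) u0 x = 0].

(* The ratio is 0 on the diagonal x = y, which is a null set; letting x, y
   range over R allows for differences across the seam of the torus. *)
Definition rarefaction_free (R : realType) (u0 : R -> R) : Prop :=
  exists2 M : R, 0 < M &
    (ess_sup (@lebesgue_measure R \x @lebesgue_measure R)
       (fun z => ((u0 z.1 - u0 z.2) / (z.1 - z.2))%:E) <= M%:E)%E.

Definition primitive_of (R : realType) (u0 v0 : R -> R) : Prop :=
  periodic1 v0 /\
  forall a b, a <= b ->
    v0 b - v0 a = \int[lebesgue_measure]_(y in `[a, b]) u0 y.

Definition C1_2 (R : realType) (phi : R -> R -> R) : Prop :=
  [/\ forall x t, derivable (phi ^~ t) x 1 /\ derivable (phi x) t 1,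
      continuous (fun z : R * R => derive1 (phi ^~ z.2) z.1)
    & continuous (fun z : R * R => derive1 (phi z.1) z.2)].

(* Viscosity solution (in the sense of Crandall and Lions) of
     v_t + H(x,t,c + v_x) = hc  on the torus times (0,T),  v(.,0) = v0,
   continuous up to t = 0 and t = T. *)
Record viscosity_solution (R : realType) (H : R -> R -> R -> R) (c hc T : R)
    (v0 : R -> R) (v : R -> R -> R) : Prop := {
  visc_per : periodic1 v;
  visc_cont : {within [set: R] `*` `[0, T],
                continuous (fun z : R * R => v z.1 z.2)};
  visc_init : forall x, v x 0 = v0 x;
  visc_sub : forall (phi : R -> R -> R) x t, C1_2 phi -> 0 < t < T ->
    (\forall z \near ((x, t) : R * R),
       v z.1 z.2 - phi z.1 z.2 <= v x t - phi x t) ->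
    derive1 (phi x) t + H x t (c + derive1 (phi ^~ t) x) <= hc;
  visc_super : forall (phi : R -> R -> R) x t, C1_2 phi -> 0 < t < T ->
    (\forall z \near ((x, t) : R * R),
       v x t - phi x t <= v z.1 z.2 - phi z.1 z.2) ->
    hc <= derive1 (phi x) t + H x t (c + derive1 (phi ^~ t) x) }.

Definition regular_pt (R : realType) (v : R -> R -> R) (x t : R) : Prop :=
  derivable (v ^~ t) x 1.

Definition v_x (R : realType) (v : R -> R -> R) (x t : R) : R :=
  derive1 (v ^~ t) x.

(* The entropy solution of u_t + H(x,t,c+u)_x = 0, u(.,0) = u0, always through
   its representative u = v_x (whose values at the non-regular points carry no
   information). *)
Definition entropy_solution (R : realType) (H : R -> R -> R -> R) (c hc T : R)
    (u0 : R -> R) (u : R -> R -> R) : Prop :=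
  exists v0 v, [/\ primitive_of u0 v0, viscosity_solution H c hc T v0 v
    & u = v_x v].

Definition mesh_dx (R : realType) (N : nat) : R := (2 * N)%:R^-1.
Definition mesh_dt (R : realType) (K : nat) : R := (2 * K)%:R^-1.
Definition mesh_lambda (R : realType) (N K : nat) : R :=
  mesh_dt R K / mesh_dx R N.
Definition node_x (R : realType) (N : nat) (m : int) : R :=
  m%:~R * mesh_dx R N.
Definition node_t (R : realType) (K k : nat) : R := k%:R * mesh_dt R K.
Definition is_mesh (N K : nat) : Prop := (0 < N <= K)%N.

Definition even_node (k : nat) (m : int) : bool := (2 %| m + k%:Z)%Z.

(* Grid functions are indexed by k : nat and m : int; only the values on one
   parity class of m + k are constrained and used. *)

(* Initial data u^0_m are the averages of u0 over [x_{m-1}, x_{m+1}]. *)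
Record LF_solution (R : realType) (H : R -> R -> R -> R) (c : R) (u0 : R -> R)
    (N K : nat) (U : nat -> int -> R) : Prop := {
  LF_scheme : forall k m, even_node k m ->
    (U k.+1 (m + 1) - (U k m + U k (m + 2)) / 2) / mesh_dt R K
    + (H (node_x R N (m + 2)) (node_t R K k) (c + U k (m + 2))
       - H (node_x R N m) (node_t R K k) (c + U k m)) / (2 * mesh_dx R N) = 0;
  LF_per : forall k m, even_node k m -> U k (m + (2 * N)%:Z) = U k m;
  LF_init : forall m, even_node 0 m ->
    U 0%N m = (2 * mesh_dx R N)^-1 *
      \int[lebesgue_measure]_(y in `[node_x R N m - mesh_dx R N,
                                     node_x R N m + mesh_dx R N]) u0 y }.

Record HJ_solution (R : realType) (H : R -> R -> R -> R) (c hc : R)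
    (v0 : R -> R) (N K : nat) (V : nat -> int -> R) : Prop := {
  HJ_scheme : forall k m, even_node k m ->
    (V k.+1 m - (V k (m - 1) + V k (m + 1)) / 2) / mesh_dt R K
    + H (node_x R N m) (node_t R K k)
        (c + (V k (m + 1) - V k (m - 1)) / (2 * mesh_dx R N)) = hc;
  HJ_per : forall k m, even_node k (m + 1) -> V k (m + (2 * N)%:Z) = V k m;
  HJ_init : forall m, even_node 0 m ->
    V 0%N (m + 1) = v0 (node_x R N (m + 1)) }.

(* k(t), for t >= 0. *)
Definition step_of (R : realType) (K : nat) (t : R) : nat :=
  Num.truncn (t / mesh_dt R K).

(* The unique m with m + k even and x_{m-1} <= x < x_{m+1}. *)
Definition cell_of (R : realType) (N k : nat) (x : R) : int :=
  2 * Num.floor ((x / mesh_dx R N + 1 - k%:R) / 2) + k%:Z.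

Definition u_Delta (R : realType) (N K : nat) (U : nat -> int -> R)
    (x t : R) : R :=
  U (step_of K t) (cell_of N (step_of K t) x).

Definition v_Delta (R : realType) (N K : nat) (V : nat -> int -> R)
    (x t : R) : R :=
  let k := step_of K t in
  let m := cell_of N k x in
  V k (m - 1) + (V k (m + 1) - V k (m - 1)) / (2 * mesh_dx R N)
                * (x - node_x R N (m - 1)).

(* The properties of the constants lambda1 and delta0 known from earlier work:
   CFL bound, and convergence of the schemes along meshes with
   lam0 <= lambda < lambda1. *)
Record CFL_constants (R : realType) (H : R -> R -> R -> R) (h : R -> R)
    (T r c0 c1 lambda1 delta0 : R) : Prop := {
  cfl_lambda1_gt0 : 0 < lambda1;
  cfl_delta0_gt0 : 0 < delta0;
  cfl_bound : forall N K c u0 U, is_mesh N K ->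
    mesh_lambda R N K < lambda1 -> mesh_dx R N <= delta0 ->
    c0 <= c <= c1 -> Linf_r0 r u0 -> LF_solution H c u0 N K U ->
    forall k m, (k < step_of K T)%N -> even_node k m ->
      `|Dp H (node_x R N m) (node_t R K k) (c + U k m)|
        <= lambda1^-1 < (mesh_lambda R N K)^-1;
  cfl_cvg_v : forall lam0, 0 < lam0 -> exists beta2 delta : R,
    [/\ 0 < beta2, 0 < delta
      & forall N K c u0 v0 v V, is_mesh N K ->
          lam0 <= mesh_lambda R N K < lambda1 -> mesh_dx R N <= delta ->
          c0 <= c <= c1 -> Linf_r0 r u0 -> primitive_of u0 v0 ->
          viscosity_solution H c (h c) T v0 v ->
          HJ_solution H c (h c) v0 N K V ->
          forall x t, 0 <= t <= T ->
            `|v_Delta N K V x t - v x t| <= beta2 * Num.sqrt (mesh_dx R N)];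
  cfl_cvg_u : forall lam0, 0 < lam0 -> forall c u0 v0 v,
    c0 <= c <= c1 -> Linf_r0 r u0 -> primitive_of u0 v0 ->
    viscosity_solution H c (h c) T v0 v ->
    forall x t, 0 < t <= T -> regular_pt v x t ->
    forall eps, 0 < eps -> exists2 delta : R, 0 < delta &
      forall N K U, is_mesh N K ->
        lam0 <= mesh_lambda R N K < lambda1 -> mesh_dx R N <= delta ->
        LF_solution H c u0 N K U ->
        `|u_Delta N K U x t - v_x v x t| < eps }.

Definition ustar (R : realType) (H : R -> R -> R -> R) (c0 c1 lambda1 : R) : R :=
  sup [set y | exists x t c xi, [/\ c0 <= c <= c1, `|xi| <= lambda1^-1
                 & y = `|Dp (Lc H c) x t xi|]].

Definition abs_values (R : realType) (F : R -> R -> R -> R) (c0 c1 us : R) :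
    set R :=
  [set y | exists x t c u, [/\ c0 <= c <= c1, `|u| <= us
             & y = `|F x t (c + u)|]].

Definition Hxx_star (R : realType) (H : R -> R -> R -> R) (c0 c1 lambda1 : R) :=
  sup (abs_values (Dx (Dx H)) c0 c1 (ustar H c0 c1 lambda1)).

Definition Hxp_star (R : realType) (H : R -> R -> R -> R) (c0 c1 lambda1 : R) :=
  sup (abs_values (Dp (Dx H)) c0 c1 (ustar H c0 c1 lambda1)).

(* An infimum, unlike the two suprema above. *)
Definition Hpp_star (R : realType) (H : R -> R -> R -> R) (c0 c1 lambda1 : R) :=
  inf (abs_values (Dp (Dp H)) c0 c1 (ustar H c0 c1 lambda1)).

Definition eta_star (R : realType) (H : R -> R -> R -> R) (c0 c1 lambda1 : R) :=
  Num.max (2 * Hxp_star H c0 c1 lambda1 + Hpp_star H c0 c1 lambda1)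
          (2^-1 * Hpp_star H c0 c1 lambda1 + Hxx_star H c0 c1 lambda1).

Definition E_star (R : realType) (H : R -> R -> R -> R) (c0 c1 lambda1 : R) :=
  let Hxx := Hxx_star H c0 c1 lambda1 in
  let Hxp := Hxp_star H c0 c1 lambda1 in
  let Hpp := Hpp_star H c0 c1 lambda1 in
  2 * Hxp / Hpp + Num.sqrt (4 * (Hxp / Hpp) ^+ 2 + 2 * Hxx / Hpp).

(* The bound dt < (E* Hpp* + 2 Hxp* )^-1 is stated multiplicatively: its
   denominator vanishes, and the bound is void, when Hxx* = Hxp* = 0, whereas
   0^-1 = 0 in MathComp. The number eta is always positive. *)
Record mesh_conditions (R : realType) (H : R -> R -> R -> R)
    (r c0 c1 lambda0 lambda1 delta0 : R) (N K : nat) : Prop := {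
  mesh_is_mesh : is_mesh N K;
  mesh_ratio : lambda0 <= mesh_lambda R N K < lambda1;
  mesh_dx_small : mesh_dx R N <= delta0;
  mesh_dt_eta : mesh_dt R K < (2 * eta_star H c0 c1 lambda1)^-1;
  mesh_dt_E : mesh_dt R K *
    (E_star H c0 c1 lambda1 * Hpp_star H c0 c1 lambda1
     + 2 * Hxp_star H c0 c1 lambda1) < 1;
  mesh_cfl :
    sup [set y | exists x t c u,
           [/\ c0 <= c <= c1, `|u| <= ustar H c0 c1 lambda1
             & y = mesh_lambda R N K *
                   (`|Dp H x t (c + u)|
                    + Hxp_star H c0 c1 lambda1 * (2 * mesh_dx R N))]] < 1;
  mesh_lambda_small : mesh_lambda R N K <=
    (1 - 2 * Hxp_star H c0 c1 lambda1 * mesh_dt R K)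
    / (r * Hpp_star H c0 c1 lambda1
       + (1 + Hpp_star H c0 c1 lambda1) * mesh_dx R N) }.

Definition L1_dist (R : realType) (f g : R -> R) : \bar R :=
  (\int[lebesgue_measure]_(x in `[0%R, 1%R]) `|f x - g x|%:E)%E.

Definition lipschitz_sol (R : realType) (T : R) (u : R -> R -> R) : Prop :=
  [lipschitz u z.1 z.2 | z in ([set: R] `*` `[0, T] : set (R * R))].

(* Main.v *)
Require Import Defs.
From mathcomp Require Import all_boot all_order all_algebra.
From mathcomp Require Import all_classical all_reals all_analysis.
From mathcomp Require Import ess_sup_inf measurable_realfun.
From mathcomp Require Import ring lra zify.
Set Implicit Arguments.
Unset Strict Implicit.
Unset Printing Implicit Defensive.
Import Order.TTheory GRing.Theory Num.Theory.
Import numFieldNormedType.Exports.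
Local Open Scope classical_set_scope.
Local Open Scope ring_scope.

(** The entropy solution is the space derivative of the viscosity solution [v], and
    the difference solution is the space derivative of the piecewise linear [v_Delta];
    the two primitives are uniformly [sqrt dx]-close. Closeness of functions says
    nothing about their derivatives in general, but it does once both functions are
    semiconcave: if [f - M x^2] is concave, its difference quotients of width [w] bracket
    the derivative from both sides up to [M w], and over a period the gap between the two
    brackets integrates to exactly [2 M w], because the quotients of a periodic function
    integrate to zero ([gap_integral]). Primitives at distance [e] therefore have
    derivatives at L1 distance of order [M w + e / w] ([L1_dist_derive]), and
    [w = dx^(1/4)], [e = sqrt dx] give the rate [dx^(1/4)]. When [u] is Lipschitz the gap
    is of order [w] at every point and the same balance gives the uniform bound
    ([lipschitz_slopes], [sup_rate_bound]).

    What remains is semiconcavity with a constant independent of the mesh, that is, a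
    one-sided bound [U k (m + 2) - U k m <= 2 dx * e_k]. Expanding [H] to second order
    around the middle node ([ham_taylor], [LF_osl_step]), one step of the scheme turns
    [e_k] into at most [e + dt (A + 2 B e - C e^2 / 2)] with [A], [B], [C] the extremal
    values of [|H_xx|], [|H_xp|], [H_pp]: a discrete Riccati inequality, whose stationary
    point is the constant [E_star]. Hence [e_k <= E_star + 2 / (C t)] for arbitrary data
    ([LF_osl_decay]), which blows up only as [t] tends to 0, while data with a one-sided
    bound keep one uniformly in time ([LF_osl_uniform]). The bounds on the derivatives of
    [H] apply because the CFL estimate on the speeds [H_p] is, by Legendre duality, an
    estimate on the slopes ([norm_le_ustar]).

    The viscosity solution inherits the one-sided bound in the limit along refinements
    of one given mesh, which all satisfy the same smallness conditions
    ([stable_mesh_refine], [viscosity_semiconcave]). Rarefaction-free data satisfy the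
    one-sided bound by averaging over pairs of points; if [u] is Lipschitz up to [t = 0],
    the data agree a.e. with a Lipschitz function by Lebesgue differentiation. *)

(** * Periodic functions and compactness *)

Section periodic.
Variable R : realType.

Lemma periodic1_int (A : Type) (f : R -> A) : periodic1 f ->
  forall (n : int) x, f (x + n%:~R) = f x.
Proof.
move=> fp.
have fpn (n : nat) x : f (x + n%:R) = f x.
  elim: n x => [|n IH] x; first by rewrite addr0.
  by rewrite -natr1 addrA fp IH.
case=> n x; first exact: fpn.
by have := fpn n.+1 (x - n.+1%:R); rewrite subrK NegzE mulrNz => ->.
Qed.

Lemma periodic1_reduce (A : Type) (f : R -> A) : periodic1 f ->
  forall x, exists2 y, 0 <= y <= 1 & f x = f y.
Proof.
move=> fp x; exists (x - (Num.floor x)%:~R).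
  have := Num.Theory.floor_itv x => /andP[h1 h2].
  by rewrite intrD in h2; apply/andP; split; lra.
by rewrite -[RHS](periodic1_int fp (Num.floor x)) subrK.
Qed.

Lemma derive1_shift (f : R -> R) (a x : R) :
  derive1 (fun y => f (y + a)) x = derive1 f (x + a).
Proof.
rewrite /derive1; congr (lim _).
have -> // : (fun h : R => h^-1 *: (f (h + x + a) - f (x + a))) =
  (fun h : R => h^-1 *: (f (h + (x + a)) - f (x + a))).
by apply/funext => h; rewrite addrA.
Qed.

Lemma Dx_periodic_x (F : R -> R -> R -> R) : periodic1 F -> periodic1 (Dx F).
Proof.
move=> Fp x; apply/funext => t; apply/funext => p; rewrite /Dx.
rewrite -(derive1_shift (fun y => F y t p)); congr (derive1 _ x).
by apply/funext => y; rewrite Fp.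
Qed.

Lemma Dx_periodic_t (F : R -> R -> R -> R) :
  (forall x, periodic1 (F x)) -> forall x, periodic1 (Dx F x).
Proof.
move=> Fp x t; apply/funext => p; rewrite /Dx; congr (derive1 _ x).
by apply/funext => y; rewrite Fp.
Qed.

Lemma Dp_periodic_x (F : R -> R -> R -> R) : periodic1 F -> periodic1 (Dp F).
Proof. by move=> Fp x; apply/funext => t; apply/funext => p; rewrite /Dp Fp. Qed.

Lemma Dp_periodic_t (F : R -> R -> R -> R) :
  (forall x, periodic1 (F x)) -> forall x, periodic1 (Dp F x).
Proof. by move=> Fp x t; apply/funext => p; rewrite /Dp Fp. Qed.

Lemma periodic_bounded (F : R -> R -> R -> R) (B : R) :
  jointly_continuous F -> periodic1 F -> (forall x, periodic1 (F x)) ->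
  exists C, forall x t p, `|p| <= B -> `|F x t p| <= C.
Proof.
move=> cF px pt.
pose K : set (R * R * R) := (`[0, 1] `*` `[0, 1]) `*` `[- B, B].
have cK : compact K.
  by apply: compact_setX; [apply: compact_setX|]; exact: segment_compact.
have /compact_bounded[M [_ HM]] := continuous_compact
  (continuous_subspaceT cF : {within K, continuous _}) cK.
exists (M + 1) => x t p hp.
have [x' hx' ->] := periodic1_reduce px x.
have [t' ht' ->] := periodic1_reduce (pt x') t.
apply: (HM (M + 1)); first lra.
exists (x', t', p) => //; split => /=; first by split; rewrite /= in_itv.
by rewrite in_itv /= -ler_norml.
Qed.

(** Boundedness of the continuous function [1 / F]. *)
Lemma periodic_pos_lower_bound (F : R -> R -> R -> R) (B : R) :
  jointly_continuous F -> periodic1 F -> (forall x, periodic1 (F x)) ->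
  (forall x t p, 0 < F x t p) ->
  exists2 m, 0 < m & forall x t p, `|p| <= B -> m <= F x t p.
Proof.
move=> cF px pt F0.
have [C HC] : exists C, forall x t p, `|p| <= B -> `|(F x t p)^-1| <= C.
  apply: (@periodic_bounded (fun x t p => (F x t p)^-1)).
  - by move=> z; apply: cvgV; [rewrite gt_eqF|exact: cF].
  - by move=> x; rewrite px.
  - by move=> x t; rewrite pt.
have D0 : 0 < Num.max C 1 by rewrite lt_max ltr01 orbT.
exists (Num.max C 1)^-1; first by rewrite invr_gt0.
move=> x t p hp; rewrite -[leRHS]invrK lef_pV2 ?posrE ?invr_gt0 //.
by rewrite (le_trans (ler_norm _)) // (le_trans (HC _ _ _ hp)) // le_max lexx.
Qed.

End periodic.

(** * One-variable calculus *)

Section calculus.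
Variable R : realType.
Implicit Types f : R -> R.

Lemma derive1_of_quotient f x l :
  (forall eps, 0 < eps -> exists2 d, 0 < d & forall h, h != 0 -> `|h| < d ->
     `|(f (x + h) - f x) / h - l| <= eps) ->
  is_derive x (1 : R) f l.
Proof.
move=> hf.
have cv : (fun h => h^-1 *: ((f \o shift x) (h *: (1 : R)) - f x)) @ 0^' --> l.
  apply/cvgrPdist_le => e e0; have [d d0 hd] := hf e e0.
  near=> h; rewrite distrC.
  have -> : h^-1 *: ((f \o shift x) (h *: (1 : R)) - f x)
            = (f (x + h) - f x) / h.
    by rewrite /= /GRing.scale /= mulr1 mulrC [h + x]addrC.
  apply: hd; first by near: h; exact: nbhs_dnbhs_neq.
  near: h; apply: dnbhs0_lt; exact: d0.
apply: DeriveDef; first by apply/cvg_ex; exists l.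
exact/cvg_lim.
Unshelve. all: by end_near. Qed.

Lemma mvt_between f (df : R -> R) (a b : R) :
  (forall x, is_derive x (1 : R) f (df x)) ->
  exists2 s, 0 <= s <= 1 & f b - f a = df (a + s * (b - a)) * (b - a).
Proof.
move=> hf.
have cf A : {within A, continuous f}.
  apply: continuous_subspaceT => x; apply: differentiable_continuous.
  by apply/derivable1_diffP; apply: (@ex_derive _ _ _ _ _ _ _ (hf x)).
wlog ab : a b / a <= b.
  move=> W; have [/W//|/ltW/W[s hs e]] := leP a b.
  exists (1 - s); first by lra.
  rewrite -[LHS]opprB e (_ : a + (1 - s) * (b - a) = b + s * (a - b)); ring.
have [<-|ab'] := eqVneq a b.
  by exists 0; rewrite ?lexx ?ler01 // !subrr mulr0.
have ba0 : 0 < b - a by rewrite subr_gt0 lt_neqAle ab' ab.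
have [c /[!in_itv]/=/andP[ac cb] e] := MVT_segment ab (fun x _ => hf x) (cf _).
exists ((c - a) / (b - a)).
  rewrite divr_ge0 ?subr_ge0 //= ler_pdivrMr // mul1r; lra.
by rewrite e divfK ?gt_eqF // [a + (c - a)]addrC subrK.
Qed.

Lemma taylor2_ge f (f1 f2 : R -> R) (m a b : R) :
  (forall x, is_derive x (1 : R) f (f1 x)) ->
  (forall x, is_derive x (1 : R) f1 (f2 x)) ->
  (forall s, 0 <= s <= 1 -> m <= f2 (a + s * (b - a))) ->
  f a + f1 a * (b - a) + m / 2 * (b - a) ^+ 2 <= f b.
Proof.
move=> hf hf1 hm.
pose g x := f x - (f1 a * (x - a) + m / 2 * (x - a) ^+ 2).
have hg x : is_derive x (1 : R) g (f1 x - (f1 a + m * (x - a))).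
  rewrite /g; apply: is_derive_eq.
  by rewrite /GRing.scale /=; field.
have [s /andP[s0 s1]] := mvt_between a b hg.
have [s' /andP[s'0 s'1]] := mvt_between a (a + s * (b - a)) hf1.
rewrite (_ : a + s * (b - a) - a = s * (b - a)); last by ring.
rewrite mulrA => e1.
have ss : 0 <= s' * s <= 1 by rewrite mulr_ge0 //= mulr_ile1.
have := hm _ ss; set z := f2 _ in e1 * => mz.
have -> : f1 (a + s * (b - a)) = f1 a + z * (s * (b - a)) by rewrite -e1; ring.
move=> e; rewrite -subr_ge0.
have -> : f b - (f a + f1 a * (b - a) + m / 2 * (b - a) ^+ 2) =
   (z - m) * s * (b - a) ^+ 2.
  move: e; rewrite /g subrr expr0n /= !mulr0 addr0 subr0 => e.
  have -> : f b - (f a + f1 a * (b - a) + m / 2 * (b - a) ^+ 2) =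
     f b - (f1 a * (b - a) + m / 2 * (b - a) ^+ 2) - f a by ring.
  by rewrite e; field.
by rewrite mulr_ge0 ?sqr_ge0 // mulr_ge0 // subr_ge0.
Qed.

End calculus.

(** * The Hamiltonian and its Legendre transform *)

Section partials.
Variable R : realType.

Lemma derivable_is_derive1 (f : R -> R) x :
  derivable f x 1 -> is_derive x (1 : R) f (derive1 f x).
Proof. by move=> df; rewrite derive1E; exact: derivableP. Qed.

Lemma C1_is_derive_x (F : R -> R -> R -> R) : C1_3 F ->
  forall x t p, is_derive x (1 : R) (fun y => F y t p) (Dx F x t p).
Proof. by move=> [d _ _ _] x t p; apply: derivable_is_derive1; case: (d x t p). Qed.

Lemma C1_is_derive_p (F : R -> R -> R -> R) : C1_3 F ->
  forall x t p, is_derive p (1 : R) (F x t) (Dp F x t p).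
Proof. by move=> [d _ _ _] x t p; apply: derivable_is_derive1; case: (d x t p). Qed.

Lemma jointly_continuous_p (F : R -> R -> R -> R) : jointly_continuous F ->
  forall x t, continuous (F x t).
Proof.
move=> cF x t p.
have h : (fun q : R => (x, t, q)) @ p --> (x, t, p).
  exact: (cvg_pair (cvg_cst (x, t)) cvg_id).
exact: (cvg_comp _ _ h (cF (x, t, p))).
Qed.

Lemma jointly_continuous_xt (F : R -> R -> R -> R) : jointly_continuous F ->
  forall p, continuous (fun z : R * R => F z.1 z.2 p).
Proof.
move=> cF p z.
have h : (fun w : R * R => (w, p)) @ z --> (z, p).
  exact: (cvg_pair cvg_id (cvg_cst p)).
exact: (cvg_comp _ _ h (cF (z, p))).
Qed.

End partials.

Section coercive.
Variable R : realType.

(** The threshold found at one point of the torus works on a neighbourhood by continuity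
    in [(x, t)] and for all larger [p] by monotonicity; compactness makes it uniform. *)
Lemma coercive_uniform (G : R -> R -> R -> R) (B : R) :
  (forall p, continuous (fun z : R * R => G z.1 z.2 p)) ->
  (forall x t p q, p <= q -> G x t p <= G x t q) ->
  periodic1 G -> (forall x, periodic1 (G x)) ->
  (forall x t, exists p, B < G x t p) ->
  exists P, forall x t p, P <= p -> B < G x t p.
Proof.
move=> cG mG px pt uG.
have /compact_near_coveringP cK : compact (`[0, 1] `*` `[0, 1] : set (R * R)).
  by apply: compact_setX; exact: segment_compact.
have := cK _ (pinfty_nbhs R) (fun P z => forall p, P <= p -> B < G z.1 z.2 p) _.
case=> [|M [_ HM]].
  move=> [x t] _; have [p0 hp0] := uG x t.
  have nz : \forall z \near (x, t), B < G z.1 z.2 p0.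
    exact: (@cvgr_gt _ _ (nbhs (x, t)) _ (fun z => G z.1 z.2 p0) _ (cG p0 (x, t)) B hp0).
  have nP : \forall P \near pinfty_nbhs R, p0 <= P.
    by apply: nbhs_pinfty_ge; rewrite num_real.
  exists ([set z | B < G z.1 z.2 p0], [set P | p0 <= P]); first by split.
  move=> [z P] [/= h1 h2] p Pp; apply: (lt_le_trans h1).
  exact/mG/(le_trans h2).
exists (M + 1) => x t p hp.
have [x' hx' ->] := periodic1_reduce px x.
have [t' ht' ->] := periodic1_reduce (pt x') t.
apply: (HM (M + 1) _ (x', t')) => //; first lra.
Qed.

End coercive.

Section hamiltonian_facts.
Variables (R : realType) (H : R -> R -> R -> R).
Hypothesis hH : hamiltonian H.

Let C1H : C1_3 H. Proof. by case: (ham_C2 hH). Qed.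
Let C1Hx : C1_3 (Dx H). Proof. by case: (ham_C2 hH). Qed.
Let C1Hp : C1_3 (Dp H). Proof. by case: (ham_C2 hH). Qed.

Lemma ham_continuous_Dp : jointly_continuous (Dp H).
Proof. by case: C1H. Qed.
Lemma ham_continuous_Dxx : jointly_continuous (Dx (Dx H)).
Proof. by case: C1Hx. Qed.
Lemma ham_continuous_Dxp : jointly_continuous (Dp (Dx H)).
Proof. by case: C1Hx. Qed.
Lemma ham_continuous_Dpp : jointly_continuous (Dp (Dp H)).
Proof. by case: C1Hp. Qed.

Lemma ham_Dp_mono x t p q : p <= q -> Dp H x t p <= Dp H x t q.
Proof.
move=> pq; have [s _ e] := mvt_between p q (C1_is_derive_p C1Hp x t).
by rewrite -subr_ge0 e mulr_ge0 ?subr_ge0 // ltW // ham_convex.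
Qed.

Lemma ham_Dp_smono x t p q : p < q -> Dp H x t p < Dp H x t q.
Proof.
move=> pq; have [s _ e] := mvt_between p q (C1_is_derive_p C1Hp x t).
by rewrite -subr_gt0 e mulr_gt0 ?subr_gt0 // ham_convex.
Qed.

Lemma ham_tangent x t p q : H x t p + Dp H x t p * (q - p) <= H x t q.
Proof.
have := @taylor2_ge R (H x t) _ _ 0 p q (C1_is_derive_p C1H x t)
  (C1_is_derive_p C1Hp x t).
by rewrite mul0r mul0r addr0; apply => s _; rewrite ltW // ham_convex.
Qed.

(** The tangent at [p] stays below [H] at [0], so [p H_p >= H(p) - H(0)], and the right
    side grows superlinearly. *)
Lemma ham_Dp_unbounded_above x t B : exists p, B < Dp H x t p.
Proof.
have /cvgryPge/(_ (`|B| + `|H x t 0| + 1)) h := ham_superlinear_pos hH x t.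
have h1 : \forall p \near pinfty_nbhs R, 1 <= p.
  by apply: nbhs_pinfty_ge; rewrite num_real.
have [p [hp p1]] := filter_ex (filterI h h1).
exists p.
have p0 : 0 < p by lra.
rewrite /= (gtr0_norm p0) in hp.
rewrite ler_pdivlMr // in hp.
have := ham_tangent x t p 0; rewrite sub0r mulrN => ht.
have h0 := ler_norm (H x t 0); have hB := ler_norm B.
have n0 := normr_ge0 (H x t 0); have nB := normr_ge0 B.
rewrite -(ltr_pM2r p0).
have k1 : 0 <= `|H x t 0| * (p - 1) by rewrite mulr_ge0 // subr_ge0.
have k2 : 0 <= (`|B| - B) * p by rewrite mulr_ge0 ?subr_ge0 // ltW.
lra.
Qed.

Lemma ham_Dp_unbounded_below x t B : exists p, Dp H x t p < B.
Proof.
have /cvgryPge/(_ (`|B| + `|H x t 0| + 1)) h := ham_superlinear_neg hH x t.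
have h1 : \forall p \near ninfty_nbhs R, p <= -1.
  by apply: nbhs_ninfty_le; rewrite num_real.
have [p [hp p1]] := filter_ex (filterI h h1).
exists p.
have p0 : 0 < - p by lra.
have pn : p < 0 by lra.
rewrite /= (ltr0_norm pn) in hp.
rewrite ler_pdivlMr // in hp.
have := ham_tangent x t p 0; rewrite sub0r mulrN => ht.
have h0 := ler_norm (H x t 0); have hB := ler_norm (- B); rewrite normrN in hB.
have n0 := normr_ge0 (H x t 0); have nB := normr_ge0 B.
rewrite -(ltr_pM2r p0).
have k1 : 0 <= `|H x t 0| * (- p - 1) by rewrite mulr_ge0 // subr_ge0; lra.
have k2 : 0 <= (`|B| + B) * (- p) by rewrite mulr_ge0 // ?(ltW p0) //; lra.
lra.
Qed.

Lemma ham_Dp_onto x t xi : exists p, Dp H x t p = xi.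
Proof.
have [b hb] := ham_Dp_unbounded_above x t xi.
have [a ha] := ham_Dp_unbounded_below x t xi.
have ab : a <= b.
  by rewrite leNgt; apply/negP => /ltW/(ham_Dp_mono x t); lra.
have cD : {within `[a, b], continuous (Dp H x t)}.
  by apply: continuous_subspaceT; exact: (jointly_continuous_p ham_continuous_Dp).
have mM : Num.min (Dp H x t a) (Dp H x t b) <= xi <= Num.max (Dp H x t a) (Dp H x t b).
  by rewrite ge_min le_max (ltW ha) (ltW hb) orbT.
by have [c _ e] := IVT ab cD mM; exists c.
Qed.

Lemma ham_Dp_coercive B : exists P, forall x t p, `|Dp H x t p| <= B -> `|p| <= P.
Proof.
have pH := ham_per_x hH; have tH := ham_per_t hH.
have pD := Dp_periodic_x pH; have tD := Dp_periodic_t tH.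
have cD := jointly_continuous_xt ham_continuous_Dp.
have [P HP] : exists P, forall x t p, P <= p -> B < Dp H x t p.
  apply: coercive_uniform => //; first exact: ham_Dp_mono.
  by move=> x t; exact: ham_Dp_unbounded_above.
have [Q HQ] : exists P, forall x t p, P <= p -> B < - Dp H x t (- p).
  apply: (@coercive_uniform R (fun x t p => - Dp H x t (- p))).
  - by move=> p z; apply: cvgN; exact: cD.
  - by move=> x t p q pq; rewrite lerN2 ham_Dp_mono // lerN2.
  - by move=> x; rewrite pD.
  - by move=> x t; rewrite tD.
  - move=> x t; have [p hp] := ham_Dp_unbounded_below x t (- B).
    by exists (- p); rewrite opprK; lra.
exists (Num.max P Q) => x t p; rewrite ler_norml => /andP[h1 h2].
rewrite ler_norml; apply/andP; split.
  rewrite lerNl le_max; apply/orP; right; rewrite leNgt; apply/negP.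
  by move=> /ltW/(HQ x t); rewrite opprK; lra.
rewrite le_max; apply/orP; left; rewrite leNgt; apply/negP.
by move=> /ltW/(HP x t); lra.
Qed.

(** By convexity the supremum over [q] is attained at the point of slope [xi]. *)
Lemma legendre_at_Dp x t p :
  legendre H x t (Dp H x t p) = Dp H x t p * p - H x t p.
Proof.
apply/eqP; rewrite eq_le; apply/andP; split.
  apply: ge_sup; first by exists (Dp H x t p * 0 - H x t 0), 0.
  by move=> _ [q _ <-]; have := ham_tangent x t p q; nra.
apply: ub_le_sup; last by exists p.
exists (Dp H x t p * p - H x t p) => _ [q _ <-].
by have := ham_tangent x t p q; nra.
Qed.

Lemma legendre_ge x t xi q : xi * q - H x t q <= legendre H x t xi.
Proof.
have [p <-] := ham_Dp_onto x t xi; rewrite legendre_at_Dp.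
by have := ham_tangent x t p q; nra.
Qed.

(** Inverting [xi = H_p]: the increment of the Legendre transform from [xi] to [xi + h]
    lies between [p h] and [q h], where [H_p(q) = xi + h], and [q] stays within [e] of [p]
    as long as [xi + h] lies between [H_p(p - e)] and [H_p(p + e)]. *)
Lemma Dp_Lc_at_Dp c x t p : Dp (Lc H c) x t (Dp H x t p) = p - c.
Proof.
set xi := Dp H x t p.
suff hd : is_derive xi (1 : R) (legendre H x t) p.
  rewrite /Dp /Lc derive1E.
  have hL : is_derive xi (1 : R) (fun q => legendre H x t q - c * q) (p - c).
    by apply: is_derive_eq; rewrite /GRing.scale /= mulr1.
  exact: (@derive_val _ _ _ _ _ _ _ hL).
apply: derive1_of_quotient => e e0.
have h1 : Dp H x t (p - e) < xi by apply: ham_Dp_smono; lra.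
have h2 : xi < Dp H x t (p + e) by apply: ham_Dp_smono; lra.
exists (Num.min (xi - Dp H x t (p - e)) (Dp H x t (p + e) - xi)).
  by rewrite lt_min !subr_gt0 h1 h2.
move=> h h0; rewrite lt_min !ltr_norml => /andP[/andP[a1 a2] /andP[b1 b2]].
have [q hq] := ham_Dp_onto x t (xi + h).
have q1 : q <= p + e.
  by rewrite leNgt; apply/negP => /(ham_Dp_smono x t); lra.
have q2 : p - e <= q.
  by rewrite leNgt; apply/negP => /(ham_Dp_smono x t); lra.
have Lxi : legendre H x t xi = xi * p - H x t p by exact: legendre_at_Dp.
have Lxh : legendre H x t (xi + h) = (xi + h) * q - H x t q.
  by rewrite -hq legendre_at_Dp.
have g1 := legendre_ge x t (xi + h) p.
have g2 := legendre_ge x t xi q.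
set D := legendre H x t (xi + h) - legendre H x t xi.
have d1 : p * h <= D by rewrite /D Lxi; lra.
have d2 : D <= q * h by rewrite /D Lxh; lra.
clearbody D.
have [hp|hn] := ltP 0 h.
  rewrite ler_norml lerBrDr ler_pdivlMr // lerBlDr ler_pdivrMr //.
  by apply/andP; split; nra.
have {hn}hn : h < 0 by rewrite lt_neqAle h0.
rewrite ler_norml lerBrDr ler_ndivlMr // lerBlDr ler_ndivrMr //.
by apply/andP; split; nra.
Qed.

End hamiltonian_facts.

(** * The constants on the range of the scheme *)

Section star_constants.
Variables (R : realType) (H : R -> R -> R -> R) (c0 c1 lambda1 : R).
Hypothesis hH : hamiltonian H.
Hypothesis lambda1_gt0 : 0 < lambda1.

Let us := ustar H c0 c1 lambda1.

Lemma norm_le_endpoints (c : R) : c0 <= c <= c1 -> `|c| <= `|c0| + `|c1|.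
Proof.
move=> /andP[h0 h1]; rewrite ler_norml.
have := ler_norm c1; have := ler_norm (- c0); rewrite normrN.
have := normr_ge0 c0; have := normr_ge0 c1.
by move=> *; apply/andP; split; lra.
Qed.

(** A bound on the speed is a bound on the slope, since [u = L^(c)_xi (H_p(c + u))]. The
    supremum defining [ustar] is a genuine one because [H_p] is coercive uniformly on the
    torus. *)
Lemma norm_le_ustar c x t u : c0 <= c <= c1 ->
  `|Dp H x t (c + u)| <= lambda1^-1 -> `|u| <= us.
Proof.
move=> hc hu; apply: ub_le_sup; last first.
  by exists x, t, c, (Dp H x t (c + u)); split => //; rewrite Dp_Lc_at_Dp // addrC addKr.
have [P HP] := ham_Dp_coercive hH lambda1^-1.
exists (P + (`|c0| + `|c1|)) => _ [x' [t' [c' [xi [hc' hxi ->]]]]].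
have [p hp] := ham_Dp_onto hH x' t' xi.
rewrite -hp Dp_Lc_at_Dp // (le_trans (ler_normB _ _)) // lerD ?norm_le_endpoints //.
by apply: (HP x' t'); rewrite hp.
Qed.

Lemma ustar_ge0 : c0 <= c1 -> 0 <= us.
Proof.
move=> c01; have [p hp] := ham_Dp_onto hH 0 0 0.
rewrite (@le_trans _ _ `|p - c0|) // (@norm_le_ustar c0 0 0) ?lexx //.
by rewrite addrC subrK hp normr0 invr_ge0 ltW.
Qed.

Let shift_le c u : c0 <= c <= c1 -> `|u| <= us -> `|c + u| <= `|c0| + `|c1| + us.
Proof. by move=> hc hu; rewrite (le_trans (ler_normD _ _)) // lerD // norm_le_endpoints. Qed.

Let abs_values_le_sup (F : R -> R -> R -> R) c x t u :
  jointly_continuous F -> periodic1 F -> (forall x, periodic1 (F x)) ->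
  c0 <= c <= c1 -> `|u| <= us ->
  `|F x t (c + u)| <= sup (abs_values F c0 c1 us).
Proof.
move=> cF px pt hc hu.
have [C HC] := periodic_bounded (`|c0| + `|c1| + us) cF px pt.
apply: ub_le_sup; last by exists x, t, c, u.
by exists C => _ [x' [t' [c' [u' [hc' hu' ->]]]]]; apply/HC/shift_le.
Qed.

Let Hpx := ham_per_x hH.
Let Hpt := ham_per_t hH.

Lemma Hxx_star_ge c x t u : c0 <= c <= c1 -> `|u| <= us ->
  `|Dx (Dx H) x t (c + u)| <= Hxx_star H c0 c1 lambda1.
Proof.
apply: abs_values_le_sup; first exact: ham_continuous_Dxx.
- exact/Dx_periodic_x/Dx_periodic_x.
- exact/Dx_periodic_t/Dx_periodic_t.
Qed.

Lemma Hxp_star_ge c x t u : c0 <= c <= c1 -> `|u| <= us ->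
  `|Dp (Dx H) x t (c + u)| <= Hxp_star H c0 c1 lambda1.
Proof.
apply: abs_values_le_sup; first exact: ham_continuous_Dxp.
- exact/Dp_periodic_x/Dx_periodic_x.
- exact/Dp_periodic_t/Dx_periodic_t.
Qed.

Lemma Hxx_star_ge0 : c0 <= c1 -> 0 <= Hxx_star H c0 c1 lambda1.
Proof.
move=> c01; apply: (le_trans _ (@Hxx_star_ge c0 0 0 0 _ _)) => //.
  by rewrite lexx.
by rewrite normr0 ustar_ge0.
Qed.

Lemma Hxp_star_ge0 : c0 <= c1 -> 0 <= Hxp_star H c0 c1 lambda1.
Proof.
move=> c01; apply: (le_trans _ (@Hxp_star_ge c0 0 0 0 _ _)) => //.
  by rewrite lexx.
by rewrite normr0 ustar_ge0.
Qed.

Let Hpp_lower : exists2 m, 0 < m &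
  forall x t p, `|p| <= `|c0| + `|c1| + us -> m <= Dp (Dp H) x t p.
Proof.
apply: periodic_pos_lower_bound; first exact: ham_continuous_Dpp.
- exact/Dp_periodic_x/Dp_periodic_x.
- exact/Dp_periodic_t/Dp_periodic_t.
- exact: ham_convex.
Qed.

Lemma Hpp_star_le c x t u : c0 <= c <= c1 -> `|u| <= us ->
  Hpp_star H c0 c1 lambda1 <= Dp (Dp H) x t (c + u).
Proof.
move=> hc hu; apply: ge_inf; last first.
  by exists x, t, c, u; split => //; rewrite gtr0_norm // ham_convex.
by exists 0 => _ [x' [t' [c' [u' [_ _ ->]]]]].
Qed.

Lemma Hpp_star_gt0 : c0 <= c1 -> 0 < Hpp_star H c0 c1 lambda1.
Proof.
move=> c01; have [m m0 hm] := Hpp_lower.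
apply: (lt_le_trans m0); apply: lb_le_inf.
  exists `|Dp (Dp H) 0 0 (c0 + 0)|, 0, 0, c0, 0.
  by rewrite lexx c01 normr0 ustar_ge0.
move=> _ [x' [t' [c' [u' [hc' hu' ->]]]]].
by rewrite (le_trans _ (ler_norm _)) // hm // shift_le.
Qed.

Lemma mesh_cfl_le lam B dx c x t u : 0 <= lam ->
  sup [set y | exists x t c u, [/\ c0 <= c <= c1, `|u| <= us
             & y = lam * (`|Dp H x t (c + u)| + B * (2 * dx))]] < 1 ->
  c0 <= c <= c1 -> `|u| <= us ->
  lam * (`|Dp H x t (c + u)| + B * (2 * dx)) <= 1.
Proof.
move=> lam0 /ltW hs hc hu; apply: le_trans hs; apply: ub_le_sup; last first.
  by exists x, t, c, u.
have [C HC] := periodic_bounded (`|c0| + `|c1| + us) (ham_continuous_Dp hH)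
  (Dp_periodic_x Hpx) (Dp_periodic_t Hpt).
exists (lam * (C + B * (2 * dx))) => _ [x' [t' [c' [u' [hc' hu' ->]]]]].
by rewrite ler_wpM2l // lerD2r HC // shift_le.
Qed.

Lemma norm_convex (M a b s : R) : 0 <= s <= 1 -> `|a| <= M -> `|b| <= M ->
  `|a + s * (b - a)| <= M.
Proof.
rewrite !ler_norml => /andP[s0 s1] /andP[a1 a2] /andP[b1 b2].
by apply/andP; split; nra.
Qed.

(** The increment is split into a step in [x] at the new momentum [c + p'] followed by a
    step in [p] at the old point [x]; comparing [H_x] at the two momenta produces the mixed
    derivative in the order in which [Hxp_star] bounds it. *)
Lemma ham_taylor c t x x' p p' : c0 <= c <= c1 -> `|p| <= us -> `|p'| <= us ->
  H x t (c + p) + Dx H x t (c + p) * (x' - x) + Dp H x t (c + p) * (p' - p)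
  - Hxx_star H c0 c1 lambda1 / 2 * (x' - x) ^+ 2
  - Hxp_star H c0 c1 lambda1 * `|(x' - x) * (p' - p)|
  + Hpp_star H c0 c1 lambda1 / 2 * (p' - p) ^+ 2 <= H x' t (c + p').
Proof.
move=> hc hp hp'; have [C1H C1Hx _ C1Hp] := ham_C2 hH.
have epp : c + p' - (c + p) = p' - p by ring.
have := @taylor2_ge R (fun y => H y t (c + p')) (fun y => Dx H y t (c + p'))
  (fun y => Dx (Dx H) y t (c + p')) (- Hxx_star H c0 c1 lambda1) x x'
  (fun y => C1_is_derive_x C1H y t _) (fun y => C1_is_derive_x C1Hx y t _).
move=> /(_ _) T1; have {}T1 := T1 (fun s _ => lerNnormlW (Hxx_star_ge _ _ hc hp')).
have := @taylor2_ge R (H x t) _ _ (Hpp_star H c0 c1 lambda1) (c + p) (c + p')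
  (C1_is_derive_p C1H x t) (C1_is_derive_p C1Hp x t).
rewrite epp => T2.
have {}T2 := T2 (fun s hs => ltac:(rewrite -addrA; exact: (Hpp_star_le _ _ hc (norm_convex hs hp hp')))).
have [s hs] := mvt_between (c + p) (c + p') (C1_is_derive_p C1Hx x t).
rewrite epp => e.
have hB : `|Dp (Dx H) x t (c + p + s * (p' - p))| <= Hxp_star H c0 c1 lambda1.
  by rewrite -addrA; exact/Hxp_star_ge/norm_convex.
set K := Dp (Dx H) _ _ _ in e hB.
have k1 : - (Hxp_star H c0 c1 lambda1 * `|(x' - x) * (p' - p)|) <=
    K * (p' - p) * (x' - x).
  rewrite lerNl (le_trans (ler_norm _)) // normrN -mulrA normrM.
  by rewrite [(p' - p) * _]mulrC ler_wpM2r.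
rewrite mulNr in T1; rewrite mulNr in T1.
have e2 : Dx H x t (c + p') = Dx H x t (c + p) + K * (p' - p) by lra.
rewrite e2 mulrDl in T1; lra.
Qed.

End star_constants.

(** * The scalar recursion for one-sided slopes *)

Section parity.

Lemma even_nodeD2 k m : even_node k (m + 2) = even_node k m.
Proof. rewrite /even_node; lia. Qed.
Lemma even_nodeB2 k m : even_node k (m - 2) = even_node k m.
Proof. rewrite /even_node; lia. Qed.
Lemma even_nodeSD1 k m : even_node k.+1 (m + 1) = even_node k m.
Proof. rewrite /even_node; lia. Qed.
Lemma even_nodeS k m : even_node k.+1 m = even_node k (m + 1).
Proof. rewrite /even_node; lia. Qed.

End parity.

Section scalar.
Variable R : realType.

(** A neighbour whose slope [x] is lower than [e] cannot do more harm than one with slope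
    [e]; its own quadratic term is dropped. *)
Lemma osl_step_half (B C dt w x e : R) : 0 <= B -> 0 < C -> 0 <= dt ->
  dt * B <= w -> x <= e -> 0 <= e ->
  w * x + dt * (B * `|x| - C / 2 * x ^+ 2) <= w * e + dt * (B * e).
Proof.
move=> B0 C0 dt0 hw xe e0.
have k0 : 0 <= dt * (C / 2 * x ^+ 2).
  by rewrite mulr_ge0 // mulr_ge0 ?sqr_ge0 // divr_ge0 // ltW.
have dB : 0 <= dt * B by rewrite mulr_ge0.
have w0 : 0 <= w by lra.
have [x0|x0] := leP 0 x.
  rewrite ger0_norm //.
  have : 0 <= (w + dt * B) * (e - x) by rewrite mulr_ge0 ?subr_ge0 // addr_ge0.
  by lra.
rewrite ltr0_norm //.
have : 0 <= (w - dt * B) * (- x) by rewrite mulr_ge0 ?subr_ge0 // oppr_ge0 ltW.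
have : 0 <= (w + dt * B) * e by rewrite mulr_ge0 // addr_ge0.
by lra.
Qed.

(** Only the larger of the two slopes keeps its quadratic term, which is where the factor
    [C / 2] rather than [C] in the conclusion comes from. The bound [dt C e <= 1] is the
    range in which the right side increases with [e]. *)
Lemma osl_step (A B C dt w1 w2 x1 x2 e : R) :
  0 <= A -> 0 <= B -> 0 < C -> 0 <= dt -> w1 + w2 = 1 ->
  dt * B <= w1 -> dt * B <= w2 -> x1 <= e -> x2 <= e -> 0 <= e ->
  dt * C * e <= 1 ->
  w1 * x1 + w2 * x2 + dt * (A + B * (`|x1| + `|x2|) - C / 2 * (x1 ^+ 2 + x2 ^+ 2))
  <= e + dt * (A + 2 * B * e - C / 2 * e ^+ 2).
Proof.
move=> A0 B0 C0 dt0 ww h1 h2.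
wlog x12 : w1 w2 x1 x2 ww h1 h2 / x2 <= x1.
  move=> W; have [le|/ltW le] := leP x2 x1; first exact: W.
  move=> h1e h2e e0 dCe.
  rewrite [w1 * _ + _]addrC [`|x1| + _]addrC [x1 ^+ 2 + _]addrC.
  by apply: W => //; rewrite addrC.
move=> x1e x2e e0 dCe.
have dB : 0 <= dt * B by rewrite mulr_ge0.
have dC : 0 <= dt * C by rewrite mulr_ge0 // ltW.
have Gmono f : 0 <= f -> f <= e ->
    f + dt * (A + 2 * B * f - C / 2 * f ^+ 2) <=
    e + dt * (A + 2 * B * e - C / 2 * e ^+ 2).
  move=> f0 fe.
  have : 0 <= (e - f) * (1 + 2 * (dt * B) - dt * C * ((e + f) / 2)).
    rewrite mulr_ge0 ?subr_ge0 //.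
    have : dt * C * ((e + f) / 2) <= dt * C * e by rewrite ler_wpM2l //; lra.
    lra.
  by lra.
have [x10|x10] := leP 0 x1.
  apply: le_trans (Gmono _ x10 x1e).
  have := osl_step_half B0 C0 dt0 h2 x12 x10.
  rewrite (ger0_norm x10) => h.
  have -> : w1 = 1 - w2 by lra.
  by lra.
apply: le_trans (Gmono 0 (lexx _) e0).
have x20 : x2 <= 0 by lra.
have := osl_step_half B0 C0 dt0 h2 x20 (lexx 0).
have := osl_step_half B0 C0 dt0 h1 (ltW x10) (lexx 0).
by rewrite expr0n /=; lra.
Qed.

(** The nonnegative root of [A + 2 B e - C e^2 / 2]. *)
Lemma E_star_stationary (A B C : R) : 0 <= A -> 0 <= B -> 0 < C ->
  let es := 2 * B / C + Num.sqrt (4 * (B / C) ^+ 2 + 2 * A / C) in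
  [/\ 0 <= es, 2 * B <= C * es & A + 2 * B * es - C / 2 * es ^+ 2 = 0].
Proof.
move=> A0 B0 C0 es; rewrite /es.
have Cn : C != 0 by rewrite gt_eqF.
have q0 : 0 <= B / C by rewrite divr_ge0 // ltW.
have a0 : 0 <= A / C by rewrite divr_ge0 // ltW.
set s := Num.sqrt _.
have s0 : 0 <= s by exact: sqrtr_ge0.
have ss : s ^+ 2 = 4 * (B / C) ^+ 2 + 2 * A / C.
  rewrite sqr_sqrtr //; have := sqr_ge0 (B / C).
  have -> : 2 * A / C = 2 * (A / C) by ring.
  by lra.
split; first by rewrite (_ : 2 * B / C = 2 * (B / C)); [lra | ring].
  rewrite mulrDr mulrCA divff // mulr1; have : 0 <= C * s by rewrite mulr_ge0 // ltW.
  by lra.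
have -> : A + 2 * B * (2 * B / C + s) - C / 2 * (2 * B / C + s) ^+ 2 =
   A + 2 * B ^+ 2 / C - C / 2 * s ^+ 2 by field.
by rewrite ss; field.
Qed.

(** With [x = dt C d], the step [d - dt C d^2 / 2] turns the bound [2 / (n + 2)] into
    [2 / (n + 3)]: the margin is half of [(2 - x (n + 2)) (2 - x) + x^2]. *)
Lemma decay_step (x n : R) : x <= 1 -> 0 <= n -> x * (n + 2) <= 2 ->
  (x - x ^+ 2 / 2) * (n + 3) <= 2.
Proof.
move=> x1 n0 hx.
have : 0 <= (2 - x * (n + 2)) * (2 - x) by rewrite mulr_ge0; lra.
have := sqr_ge0 x.
lra.
Qed.

(** The excess [d] over the stationary point decreases at least as [dt C d^2 / 2] per
    step, hence like [2 / (C t)]; counting from [k + 2] makes the bound hold at the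
    initial step, where only [dt C e <= 1] is known. *)
Lemma riccati_decay (A B C dt es e : R) (k : nat) :
  0 < C -> 0 < dt ->
  2 * B <= C * es -> A + 2 * B * es - C / 2 * es ^+ 2 = 0 -> 0 <= es ->
  es <= e -> dt * C * e <= 1 -> dt * C * (e - es) * k.+2%:R <= 2 ->
  exists e', [/\ es <= e', e' <= e, dt * C * (e' - es) * k.+3%:R <= 2
    & e + dt * (A + 2 * B * e - C / 2 * e ^+ 2) <= e'].
Proof.
move=> C0 dt0 hB hA es0 ese hd hk.
have dC : 0 < dt * C by rewrite mulr_gt0.
pose d := e - es; have d0 : 0 <= d by rewrite subr_ge0.
pose x := dt * C * d.
have x0 : 0 <= x by rewrite mulr_ge0 // ltW.
have x1 : x <= 1.
  have : 0 <= dt * C * es by rewrite mulr_ge0 // ltW.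
  by rewrite /x /d; lra.
have xd : 0 <= x * d by rewrite mulr_ge0.
exists (es + d - x * d / 2); split.
- have : 0 <= (1 - x) * d by rewrite mulr_ge0 // subr_ge0.
  by lra.
- have : es + d = e by rewrite /d; ring.
  by lra.
- have -> : dt * C * (es + d - x * d / 2 - es) = x - x ^+ 2 / 2 by rewrite /x; field.
  have -> : k.+3%:R = k%:R + 3 :> R by rewrite -[k.+3]addn3 natrD.
  apply: decay_step => //.
  by have -> : k%:R + 2 = k.+2%:R :> R by rewrite -[k.+2]addn2 natrD.
- have -> : e = es + d by rewrite /d; ring.
  have -> : A + 2 * B * (es + d) - C / 2 * (es + d) ^+ 2 =
    (A + 2 * B * es - C / 2 * es ^+ 2) + (2 * B - C * es) * d - C * d * d / 2 by field.
  rewrite hA add0r /x.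
  have : 0 <= dt * ((C * es - 2 * B) * d).
    by rewrite mulr_ge0 ?mulr_ge0 ?subr_ge0 // ltW.
  by lra.
Qed.

End scalar.

(** * Meshes and one step of the scheme *)

Section mesh.
Variable R : realType.

Lemma mesh_dx_gt0 N : (0 < N)%N -> 0 < mesh_dx R N.
Proof. by move=> N0; rewrite invr_gt0 ltr0n muln_gt0. Qed.

Lemma mesh_dt_gt0 K : (0 < K)%N -> 0 < mesh_dt R K.
Proof. by move=> K0; rewrite invr_gt0 ltr0n muln_gt0. Qed.

Lemma mesh_dx_le1 N : (0 < N)%N -> mesh_dx R N <= 1.
Proof.
by move=> N0; rewrite invf_le1 ?ltr0n ?muln_gt0 // ler1n muln_gt0.
Qed.

(** The fourth root of the mesh size is the scale of every final estimate. *)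
Lemma quarter_power N : (0 < N)%N -> let q := mesh_dx R N `^ (1 / 4) in
  [/\ 0 < q, Num.sqrt (mesh_dx R N) = q * q & mesh_dx R N <= q].
Proof.
move=> N0 q; have dx0 := mesh_dx_gt0 N0.
have q0 : 0 < q by exact: powR_gt0.
have e1 : Num.sqrt (mesh_dx R N) = q * q.
  rewrite -powR12_sqrt ?(ltW dx0) // /q -powRD; last by rewrite gt_eqF ?implybT.
  by congr (_ `^ _); field.
have e2 : mesh_dx R N = q * q * (q * q).
  by rewrite -e1 -expr2 sqr_sqrtr // ltW.
have d1 := mesh_dx_le1 N0.
have q1 : q <= 1.
  rewrite leNgt; apply/negP => q1.
  have : 1 < q * q by rewrite mulr_egt1 // ltW.
  move=> qq; have : 1 < q * q * (q * q) by rewrite mulr_egt1.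
  by rewrite -e2; lra.
have qq1 : q * q <= 1 by rewrite mulr_ile1 // ltW.
split => //; rewrite e2 -mulrA ler_piMr ?(ltW q0) //.
by rewrite mulr_ile1 ?mulr_ge0 // ltW.
Qed.

Lemma is_mesh_pos N K : is_mesh N K -> (0 < N)%N /\ (0 < K)%N.
Proof. by rewrite /is_mesh; lia. Qed.

Lemma node_xD N m n : node_x R N (m + n) = node_x R N m + n%:~R * mesh_dx R N.
Proof. by rewrite /node_x intrD mulrDl. Qed.

Lemma node_xD1 N m : node_x R N (m + 1) = node_x R N m + mesh_dx R N.
Proof. by rewrite node_xD mul1r. Qed.

Lemma node_xB1 N m : node_x R N (m - 1) = node_x R N m - mesh_dx R N.
Proof. by rewrite node_xD mulrNz mulN1r. Qed.

Lemma node_xD2 N m : node_x R N (m + 2) = node_x R N m + 2 * mesh_dx R N.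
Proof. by rewrite node_xD. Qed.

Lemma node_xB2 N m : node_x R N (m - 2) = node_x R N m - 2 * mesh_dx R N.
Proof. by rewrite node_xD mulrNz mulNr. Qed.

Lemma node_x_period N m : (0 < N)%N -> node_x R N (m + (2 * N)%:Z) = node_x R N m + 1.
Proof.
move=> N0; rewrite node_xD /mesh_dx -pmulrn divff //.
by rewrite pnatr_eq0 -lt0n muln_gt0.
Qed.

Lemma step_of_itv K (t : R) : (0 < K)%N -> 0 <= t ->
  (step_of K t)%:R * mesh_dt R K <= t < (step_of K t).+1%:R * mesh_dt R K.
Proof.
move=> K0 t0; have d0 := mesh_dt_gt0 K0.
rewrite -ler_pdivlMr // -ltr_pdivrMr //.
by apply: truncn_itv; rewrite divr_ge0 // ltW.
Qed.

Lemma step_of_le K (s t : R) : (0 < K)%N -> s <= t -> (step_of K s <= step_of K t)%N.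
Proof.
move=> K0 st; apply: le_truncn; rewrite ler_wpM2r // invr_ge0 ltW //.
exact: mesh_dt_gt0.
Qed.

End mesh.

(** The consequences of the mesh conditions on which the estimates rest, in a form whose
    invariance under refinement at constant ratio is immediate. *)
Record stable_mesh (R : realType) (H : R -> R -> R -> R)
    (r c0 c1 lambda0 lambda1 delta0 : R) (N K : nat) : Prop := {
  stable_is_mesh : is_mesh N K;
  stable_ratio : lambda0 <= mesh_lambda R N K < lambda1;
  stable_dx : mesh_dx R N <= delta0;
  stable_E : mesh_dt R K * Hpp_star H c0 c1 lambda1 * E_star H c0 c1 lambda1 <= 1;
  stable_cfl : forall c x t u, c0 <= c <= c1 -> `|u| <= ustar H c0 c1 lambda1 ->
    mesh_lambda R N K *
      (`|Dp H x t (c + u)| + Hxp_star H c0 c1 lambda1 * (2 * mesh_dx R N)) <= 1;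
  stable_r : mesh_lambda R N K * r * Hpp_star H c0 c1 lambda1 <= 1 }.

Lemma intB1D2 (m : int) : m - 1 + 2 = m + 1. Proof. lia. Qed.
Lemma intB2D1 (m : int) : m - 2 + 1 = m - 1. Proof. lia. Qed.

(** Values [ul], [um], [ur] at three consecutive nodes produce [vl], [vr] at the next time.
    In [vr - vl] the first-order terms of [H] combine the two slopes with the weights
    [(1 -+ lambda H_p) / 2], and the CFL condition keeps both weights above [dt B]. *)
Lemma LF_osl_scalar (R : realType) (A B C dx dt e Hm Hl Hr Hx Hp ul um ur vl vr : R) :
  0 <= A -> 0 <= B -> 0 < C -> 0 < dx -> 0 < dt -> 0 <= e -> dt * C * e <= 1 ->
  um - ul <= 2 * dx * e -> ur - um <= 2 * dx * e ->
  Hm + Hx * - (2 * dx) + Hp * (ul - um) - A / 2 * (- (2 * dx)) ^+ 2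
    - B * `|- (2 * dx) * (ul - um)| + C / 2 * (ul - um) ^+ 2 <= Hl ->
  Hm + Hx * (2 * dx) + Hp * (ur - um) - A / 2 * (2 * dx) ^+ 2
    - B * `|2 * dx * (ur - um)| + C / 2 * (ur - um) ^+ 2 <= Hr ->
  dt / dx * (`|Hp| + B * (2 * dx)) <= 1 ->
  (vl - (ul + um) / 2) / dt + (Hm - Hl) / (2 * dx) = 0 ->
  (vr - (um + ur) / 2) / dt + (Hr - Hm) / (2 * dx) = 0 ->
  vr - vl <= 2 * dx * (e + dt * (A + 2 * B * e - C / 2 * e ^+ 2)).
Proof.
move=> A0 B0 C0 dx0 dt0 e0 he h1 h2 Tl Tr cfl s1 s2.
have d2 : 0 < 2 * dx by rewrite mulr_gt0.
have dn : dx != 0 by rewrite gt_eqF.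
have tn : dt != 0 by rewrite gt_eqF.
have er : vr = (um + ur) / 2 - dt / (2 * dx) * (Hr - Hm).
  clear -s2 dn tn; apply/eqP; rewrite -subr_eq0; apply/eqP.
  by apply: (mulfI (invr_neq0 tn)); rewrite mulr0 -[RHS]s2; field; apply/andP.
have el : vl = (ul + um) / 2 - dt / (2 * dx) * (Hm - Hl).
  clear -s1 dn tn; apply/eqP; rewrite -subr_eq0; apply/eqP.
  by apply: (mulfI (invr_neq0 tn)); rewrite mulr0 -[RHS]s1; field; apply/andP.
pose x1 := (ur - um) / (2 * dx); pose x2 := (um - ul) / (2 * dx).
have ex1 : ur - um = 2 * dx * x1 by rewrite /x1 mulrC divfK // gt_eqF.
have ex2 : um - ul = 2 * dx * x2 by rewrite /x2 mulrC divfK // gt_eqF.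
have hx1 : x1 <= e by rewrite /x1 ler_pdivrMr // mulrC.
have hx2 : x2 <= e by rewrite /x2 ler_pdivrMr // mulrC.
clearbody x1 x2; clear h1 h2 s1 s2.
have eul : ul - um = - (2 * dx * x2) by rewrite -ex2 opprB.
have nl : `|- (2 * dx) * (ul - um)| = (2 * dx) ^+ 2 * `|x2|.
  by rewrite eul mulrNN mulrA normrM -expr2 ger0_norm // sqr_ge0.
have nr : `|2 * dx * (ur - um)| = (2 * dx) ^+ 2 * `|x1|.
  by rewrite ex1 mulrA normrM -expr2 ger0_norm // sqr_ge0.
rewrite nl eul !sqrrN in Tl; rewrite nr ex1 in Tr.
pose w1 := (1 - dt / dx * Hp) / 2; pose w2 := (1 + dt / dx * Hp) / 2.
have l0 : 0 < dt / dx by rewrite divr_gt0.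
have cfl' : dt / dx * `|Hp| + 2 * (dt * B) <= 1.
  by apply: le_trans cfl; rewrite mulrDr lerD2l le_eqVlt; apply/orP; left; apply/eqP; field.
have n1 : dt / dx * Hp <= dt / dx * `|Hp| by rewrite ler_wpM2l ?ler_norm // ltW.
have n2 : - (dt / dx * Hp) <= dt / dx * `|Hp|.
  by rewrite -mulrN -(normrN Hp) ler_wpM2l ?ler_norm // ltW.
have hw1 : dt * B <= w1 by clear -cfl' n1 n2; rewrite /w1; lra.
have hw2 : dt * B <= w2 by clear -cfl' n1 n2; rewrite /w2; lra.
have ww : w1 + w2 = 1 by rewrite /w1 /w2; field.
have := osl_step A0 B0 C0 (ltW dt0) ww hw1 hw2 hx1 hx2 e0 he.
rewrite -(ler_pM2l d2); apply: le_trans.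
have k : (dt / (2 * dx)) * (2 * Hm + Hp * (2 * dx * x1) - Hp * (2 * dx * x2)
   - A * (2 * dx) ^+ 2 - B * ((2 * dx) ^+ 2 * `|x1|) - B * ((2 * dx) ^+ 2 * `|x2|)
   + C / 2 * (2 * dx * x1) ^+ 2 + C / 2 * (2 * dx * x2) ^+ 2) <=
   (dt / (2 * dx)) * (Hl + Hr).
  rewrite ler_wpM2l ?divr_ge0 ?(ltW dt0) ?(ltW d2) //; clear -Tl Tr; lra.
rewrite er el.
rewrite -subr_ge0 in k; rewrite -subr_ge0.
apply: le_trans k _; rewrite le_eqVlt; apply/orP; left; apply/eqP.
have -> : um = ul + 2 * dx * x2 by rewrite -ex2 addrC subrK.
have -> : ur = ul + 2 * dx * x2 + 2 * dx * x1 by rewrite -ex2 -ex1; ring.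
by rewrite /w1 /w2; field.
Qed.

Section stable.
Variables (R : realType) (H : R -> R -> R -> R) (r c0 c1 lambda0 lambda1 delta0 : R).
Hypotheses (hH : hamiltonian H)
  (lambda1_gt0 : 0 < lambda1) (c01 : c0 <= c1) (r_gt0 : 0 < r).

Let A := Hxx_star H c0 c1 lambda1.
Let B := Hxp_star H c0 c1 lambda1.
Let C := Hpp_star H c0 c1 lambda1.
Let es := E_star H c0 c1 lambda1.
Let us := ustar H c0 c1 lambda1.
Let A0 : 0 <= A. Proof. exact: Hxx_star_ge0. Qed.
Let B0 : 0 <= B. Proof. exact: Hxp_star_ge0. Qed.
Let C0 : 0 < C. Proof. exact: Hpp_star_gt0. Qed.

Lemma mesh_conditions_stable N K :
  mesh_conditions H r c0 c1 lambda0 lambda1 delta0 N K ->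
  stable_mesh H r c0 c1 lambda0 lambda1 delta0 N K.
Proof.
case=> im ratio dx_small _ dtE cfl lsmall.
have [N0 K0] := is_mesh_pos im.
have dx0 := mesh_dx_gt0 R N0; have dt0 := mesh_dt_gt0 R K0.
have lam0 : 0 < mesh_lambda R N K by rewrite divr_gt0.
have BdT : 0 <= B * mesh_dt R K by rewrite mulr_ge0 // ltW.
split => //.
- move: dtE; rewrite -/B -/C -/es; lra.
- move=> c x t u hc hu; exact: (mesh_cfl_le hH x t (ltW lam0) cfl hc hu).
- move: lsmall; rewrite -/B -/C => lsmall.
  have rC : 0 < r * C by rewrite mulr_gt0.
  have Cd : 0 < (1 + C) * mesh_dx R N by rewrite mulr_gt0 // addr_gt0.
  rewrite ler_pdivlMr ?addr_gt0 // in lsmall.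
  have : 0 < mesh_lambda R N K * ((1 + C) * mesh_dx R N) by rewrite mulr_gt0.
  lra.
Qed.

Lemma stable_mesh_refine N K j : (0 < j)%N ->
  stable_mesh H r c0 c1 lambda0 lambda1 delta0 N K ->
  stable_mesh H r c0 c1 lambda0 lambda1 delta0 (j * N) (j * K).
Proof.
move=> j0 [im ratio dx_small dtE cfl lr].
have [N0 K0] := is_mesh_pos im.
have j0R : 0 < j%:R :> R by rewrite ltr0n.
have j1R : 1 <= j%:R :> R by rewrite ler1n.
have dx0 := mesh_dx_gt0 R N0; have dt0 := mesh_dt_gt0 R K0.
have edx : mesh_dx R (j * N) = mesh_dx R N / j%:R.
  by rewrite /mesh_dx mulnCA natrM invfM mulrC.
have edt : mesh_dt R (j * K) = mesh_dt R K / j%:R.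
  by rewrite /mesh_dt mulnCA natrM invfM mulrC.
have elam : mesh_lambda R (j * N) (j * K) = mesh_lambda R N K.
  by rewrite /mesh_lambda edx edt; field; rewrite !gt_eqF.
have dxle : mesh_dx R (j * N) <= mesh_dx R N.
  by rewrite edx ler_pdivrMr // ler_peMr // ltW.
have dtle : mesh_dt R (j * K) <= mesh_dt R K.
  by rewrite edt ler_pdivrMr // ler_peMr // ltW.
have [es0 _ _] := E_star_stationary A0 B0 C0.
split; rewrite ?elam //.
- by move: im; rewrite /is_mesh muln_gt0 j0 leq_pmul2l.
- exact: le_trans dx_small.
- by apply: le_trans dtE; rewrite ler_wpM2r // ler_wpM2r // ltW.
- move=> c x t u hc hu; apply: le_trans (cfl c x t u hc hu).
  rewrite ler_wpM2l //; first by rewrite divr_ge0 // ltW.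
  by rewrite lerD2l; apply: ler_wpM2l => //; apply: ler_wpM2l.
Qed.

Lemma LF_osl_step c u0 N K U k e :
  c0 <= c <= c1 -> stable_mesh H r c0 c1 lambda0 lambda1 delta0 N K ->
  LF_solution H c u0 N K U ->
  (forall m, even_node k m -> `|U k m| <= us) ->
  0 <= e -> mesh_dt R K * C * e <= 1 ->
  (forall m, even_node k m -> U k (m + 2) - U k m <= 2 * mesh_dx R N * e) ->
  forall m, even_node k.+1 m -> U k.+1 (m + 2) - U k.+1 m <=
    2 * mesh_dx R N * (e + mesh_dt R K * (A + 2 * B * e - C / 2 * e ^+ 2)).
Proof.
move=> hc st lf hu e0 he hU m'; rewrite even_nodeS.
have -> : m' = (m' + 1) - 1 by rewrite addrK.
set m := m' + 1; rewrite subrK => hm.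
rewrite intB1D2.
have [N0 K0] := is_mesh_pos (stable_is_mesh st).
have dx0 := mesh_dx_gt0 R N0; have dt0 := mesh_dt_gt0 R K0.
have hm2 : even_node k (m - 2) by rewrite even_nodeB2.
have hp2 : even_node k (m + 2) by rewrite even_nodeD2.
have := LF_scheme lf hm.
have := LF_scheme lf hm2.
rewrite intB2D1 subrK.
have := stable_cfl st (node_x R N m) (node_t R K k) hc (hu m hm).
have := ham_taylor hH (node_t R K k) (node_x R N m) (node_x R N (m + 2)) hc (hu m hm) (hu _ hp2).
have := ham_taylor hH (node_t R K k) (node_x R N m) (node_x R N (m - 2)) hc (hu m hm) (hu _ hm2).
have := hU m hm; have := hU _ hm2; rewrite subrK.
rewrite node_xD2 node_xB2 -/A -/B -/C.
set xm := node_x R N m; set tk := node_t R K k.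
have -> : xm + 2 * mesh_dx R N - xm = 2 * mesh_dx R N by rewrite addrC addKr.
have -> : xm - 2 * mesh_dx R N - xm = - (2 * mesh_dx R N) by rewrite addrC addKr.
move=> h1 h2 Tl Tr cfl s1 s2.
exact: (LF_osl_scalar A0 B0 C0 dx0 dt0 e0 he h1 h2 Tl Tr cfl s1 s2).
Qed.

End stable.

(** * Integrals of the initial data *)

Section initial_data.
Variable R : realType.
Local Notation mu := (@lebesgue_measure R).

Lemma ae_imply d (T : measurableType d) (m : {measure set T -> \bar R})
    (P Q : T -> Prop) : (forall x, P x -> Q x) ->
  {ae m, forall x, P x} -> {ae m, forall x, Q x}.
Proof.
move=> PQ [A [mA A0 PA]]; exists A; split => // x nQ; apply: PA => /PQ.
exact: nQ.
Qed.

Lemma lebesgue_measure_segment (a b : R) : a <= b ->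
  mu `[a, b] = (b - a)%:E.
Proof.
rewrite le_eqVlt => /predU1P[->|ab]; first by rewrite set_itv1 lebesgue_measure_set1 subrr.
by rewrite lebesgue_measure_itv /= lte_fin ab.
Qed.

(** Truncating [f] at [M] changes it on a null set only. *)
Lemma Rintegral_le_ae (f : R -> R) (a b M : R) : a <= b ->
  mu.-integrable `[a, b] (EFin \o f) ->
  {ae mu, forall x, `[a, b]%classic x -> f x <= M} ->
  \int[mu]_(x in `[a, b]) f x <= M * (b - a).
Proof.
move=> ab intf fM.
have mab : measurable (`[a, b]%classic : set R) by exact: measurable_itv.
have fin_ab : (mu `[a, b] < +oo)%E by rewrite lebesgue_measure_segment // ltry.
have mf : measurable_fun `[a, b] f.
  by apply/measurable_EFinP; case/integrableP : intf.
have intc : mu.-integrable `[a, b] (EFin \o cst M).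
  exact: (continuous_compact_integrable (@segment_compact _ _ _) (continuous_subspaceT (@cst_continuous _ _ M))).
have aeq : (\int[mu]_(x in `[a, b]) (f x)%:E = \int[mu]_(x in `[a, b]) (Num.min (f x) M)%:E)%E.
  apply: ae_eq_integral => //.
  - exact/measurable_EFinP.
  - by apply/measurable_EFinP; exact: measurable_minr.
  - by apply: ae_imply fM => x h /= xab; rewrite min_l // h.
have intm : mu.-integrable `[a, b] (EFin \o (fun x => Num.min (f x) M)).
  apply: (@le_integrable _ _ _ mu `[a, b] mab _ (fun x => (`|f x| + `|M|)%:E)) => //.
  - by apply/measurable_EFinP; exact: measurable_minr.
  - move=> x _; rewrite lee_fin [leRHS]ger0_norm ?addr_ge0 //.
    by rewrite /Num.min; case: ifP => _; rewrite ?lerDl ?lerDr.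
  - have i1 : mu.-integrable `[a, b] (abse \o (EFin \o f)) by exact: integrable_abse.
    have i2 : mu.-integrable `[a, b] (abse \o (EFin \o cst M)) by exact: integrable_abse.
    exact: (@integrableD _ _ _ mu `[a, b] mab _ _ i1 i2).
have -> : \int[mu]_(x in `[a, b]) f x = \int[mu]_(x in `[a, b]) Num.min (f x) M.
  by rewrite /Rintegral aeq.
apply: (@le_trans _ _ (\int[mu]_(x in `[a, b]) (cst M x))).
  by apply: le_Rintegral => // x _; rewrite ge_min lexx orbT.
by rewrite Rintegral_cst //= lebesgue_measure_segment.
Qed.

Lemma Rintegral_ge_ae (f : R -> R) (a b M : R) : a <= b ->
  mu.-integrable `[a, b] (EFin \o f) ->
  {ae mu, forall x, `[a, b]%classic x -> M <= f x} ->
  M * (b - a) <= \int[mu]_(x in `[a, b]) f x.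
Proof.
move=> ab intf fM.
have mab : measurable (`[a, b]%classic : set R) by exact: measurable_itv.
have := @Rintegral_le_ae (fun x => -1 * f x) a b (- M) ab.
rewrite RintegralZl // mulN1r mulNr lerN2; apply.
- have := integrableN intf; apply: eq_integrable => // x _.
  by rewrite /= mulN1r.
- by apply: ae_imply fM => x h xab; rewrite mulN1r lerN2 h.
Qed.

Section Linf.
Variables (r : R) (u0 : R -> R).
Hypothesis hu0 : Linf_r0 r u0.

Lemma Linf_ae_bound : {ae mu, forall x, `|u0 x| <= r}.
Proof.
have mu0 : (0 < mu [set: R])%E by rewrite -set_itvNyy lebesgue_measure_itv /= lt0y.
case: hu0 => _ _ + _; rewrite Lnorm.unlock.
case: ifPn => [_|/negP[]]; last exact: mu0.
by move=> /ess_supP; apply: ae_imply => x; rewrite /= lee_fin.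
Qed.

Lemma Linf_integrable (a b : R) : mu.-integrable `[a, b] (EFin \o u0).
Proof.
have [ab|ba] := leP a b; last first.
  by rewrite set_itv_ge ?integrable_set0 // bnd_simp -ltNge.
have mab : measurable (`[a, b]%classic : set R) by exact: measurable_itv.
have mu0 : measurable_fun `[a, b] u0 by apply: measurable_funTS; case: hu0.
apply/integrableP; split; first exact/measurable_EFinP.
apply: le_lt_trans (_ : (r%:E * mu `[a, b] < +oo)%E).
  apply: integral_le_bound => //; first exact/measurable_EFinP.
    have [x hx] : exists x, `|u0 x| <= r.
      have := Linf_ae_bound; move=> h; apply: contrapT => nx.
      have : mu.-negligible [set: R].
        by apply: negligibleS h => x _ /= hx; apply: nx; exists x.
      move/measure_negligible => /(_ measurableT) m0.
      have : (0 < mu [set: R])%E by rewrite -set_itvNyy lebesgue_measure_itv /= lt0y.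
      by rewrite lt_neqAle => /andP[/eqP/(_ (esym m0))].
    by rewrite lee_fin (le_trans _ hx).
  by apply: ae_imply Linf_ae_bound => x h _; rewrite /= lee_fin.
by rewrite lebesgue_measure_segment // -EFinM ltry.
Qed.

Lemma Linf_Rintegral_le (a b : R) : a <= b ->
  `|\int[mu]_(x in `[a, b]) u0 x| <= r * (b - a).
Proof.
move=> ab; rewrite ler_norml; apply/andP; split.
  rewrite -mulNr; apply: Rintegral_ge_ae => //; first exact: Linf_integrable.
  by apply: ae_imply Linf_ae_bound => x + _; rewrite ler_norml => /andP[].
apply: Rintegral_le_ae => //; first exact: Linf_integrable.
by apply: ae_imply Linf_ae_bound => x + _; rewrite ler_norml => /andP[].
Qed.

(** Averaging the one-sided bound first in [x], then in [y], compares the averages over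
    adjacent cells; points of the two cells are at most [2 d] apart. *)
Lemma osl_adjacent (M a d : R) : 0 < d -> 0 <= M ->
  {ae mu, forall y, {ae mu, forall x, y <= x -> u0 x <= u0 y + M * (x - y)}} ->
  \int[mu]_(x in `[a + d, a + d + d]) u0 x <=
    \int[mu]_(x in `[a, a + d]) u0 x + 2 * M * d * d.
Proof.
move=> d0 M0 osl.
set S := \int[mu]_(x in `[a + d, a + d + d]) u0 x.
have h : (S / d - 2 * M * d) * (a + d - a) <= \int[mu]_(x in `[a, a + d]) u0 x.
  apply: Rintegral_ge_ae; [lra|exact: Linf_integrable|].
  apply: ae_imply osl => y hy; rewrite /= in_itv /= => /andP[ay yd].
  have : S <= (u0 y + 2 * M * d) * (a + d + d - (a + d)).
    apply: Rintegral_le_ae; [lra|exact: Linf_integrable|].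
    apply: ae_imply hy => x hx; rewrite /= in_itv /= => /andP[ax xd].
    apply: le_trans (hx _) _; first lra.
    rewrite lerD2l [2 * M]mulrC -mulrA ler_wpM2l //; lra.
  rewrite (_ : a + d + d - (a + d) = d); last ring.
  by rewrite -ler_pdivrMr //; lra.
have -> : S = (S / d - 2 * M * d) * (a + d - a) + 2 * M * d * d.
  by field; rewrite gt_eqF.
by rewrite lerD2r.
Qed.

End Linf.

(** Tonelli for the indicator of a measurable null set: almost all of its sections are
    null. *)
Lemma ae_prod_sections (P : R * R -> Prop) :
  {ae (@lebesgue_measure R \x @lebesgue_measure R)%E, forall z, P z} ->
  {ae mu, forall y, {ae mu, forall x, P (y, x)}}.
Proof.
case=> A [mA A0 PA].
have mF : measurable_fun [set: R] (fun y => mu (xsection A y)).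
  exact: measurable_fun_xsection.
have : (\int[mu]_y `|mu (xsection A y)| = 0)%E.
  rewrite -[RHS]A0; apply: eq_integral => y _; rewrite gee0_abs //.
move/(ae_eq_integral_abs mu measurableT mF).
apply: ae_imply => y /(_ I) /= h.
exists (xsection A y); split => //; first exact: measurable_xsection.
by move=> x nP; rewrite /xsection /= inE; apply: PA.
Qed.

(** The diagonal, where the difference quotient is meaningless, is absorbed by writing the
    bound without division. *)
Lemma rarefaction_free_osl (u0 : R -> R) : rarefaction_free u0 ->
  exists2 M, 0 <= M &
  {ae mu, forall y, {ae mu, forall x, y <= x -> u0 x <= u0 y + M * (x - y)}}.
Proof.
case=> M M0 /ess_supP h; exists M; first exact: ltW.
apply: ae_imply (ae_prod_sections h) => y.
apply: ae_imply => x /=; rewrite lee_fin => {}h; rewrite le_eqVlt => /predU1P[->|yx].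
  by rewrite subrr mulr0 addr0.
have xy : 0 < x - y by rewrite subr_gt0.
rewrite -lerBlDl -ler_pdivrMr //; apply: le_trans h.
by rewrite -[y - x]opprB -[u0 y - _]opprB invrN mulrNN.
Qed.

Lemma Linf_primitive_ae_derive (r : R) (u0 v0 : R -> R) :
  Linf_r0 r u0 -> primitive_of u0 v0 ->
  {ae mu, forall x, derivable v0 x 1 /\ derive1 v0 x = u0 x}.
Proof.
move=> hu0 [_ hv0].
have locu : locally_integrable [set: R] u0.
  split; [by case: hu0|exact: openT|move=> A _ cA].
  have [M [_ HM]] := compact_bounded cA.
  have AB : A `<=` `[- (M + 1), M + 1]%classic.
    by move=> x Ax; rewrite /= in_itv /= -ler_norml; apply: (HM (M + 1)) => //; lra.
  have mI : measurable (`[- (M + 1), M + 1]%classic : set R) by exact: measurable_itv.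
  have /integrableP[mf fin] := Linf_integrable hu0 (- (M + 1)) (M + 1).
  apply: le_lt_trans fin; apply: ge0_subset_integral => //.
  - exact: compact_measurable.
  - apply/measurable_EFinP; apply: measurableT_comp => //.
    exact/measurable_EFinP.
apply: ae_imply (lebesgue_differentiation locu) => x lx.
have ax : (ereal_of_itv_bound (BLeft (x - 1)%R) < ereal_of_itv_bound (BRight x))%E.
  by rewrite /= lte_fin gtrBl.
have xx1 : x < x + 1 by rewrite ltrDl.
have [dF F'] := FTC1_lebesgue_pt xx1 (Linf_integrable hu0 (x - 1) (x + 1)) ax lx.
set F := fun y => _ in dF F'.
have vF : {near x, (fun y => v0 (x - 1) + F y) =1 v0}.
  have xx : x - 1 < x by rewrite gtrBl.
  near=> y; rewrite /F -hv0; first by rewrite addrC subrK.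
  by apply: ltW; near: y; exact: lt_nbhsr.
have hF : is_derive x (1 : R) F (u0 x).
  by rewrite -F' derive1E; exact: derivableP.
have hv : is_derive x (1 : R) (fun y => v0 (x - 1) + F y) (u0 x).
  by have := is_deriveD (is_derive_cst (v0 (x - 1)) x (1 : R)) hF; rewrite add0r.
have hd : is_derive x (1 : R) v0 (u0 x) by apply: near_eq_is_derive hv.
split; first exact: (@ex_derive _ _ _ _ _ _ _ hd).
by rewrite derive1E; exact: (@derive_val _ _ _ _ _ _ _ hd).
Unshelve. all: by end_near. Qed.

Lemma lipschitz_solP (T : R) (u : R -> R -> R) : lipschitz_sol T u ->
  exists2 L, 0 < L & forall x y t, 0 <= t <= T -> `|u x t - u y t| <= L * `|x - y|.
Proof.
case=> M [_ HM]; exists (`|M| + 1); first by rewrite ltr_wpDl.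
move=> x y t ht.
have ML : M < `|M| + 1 by rewrite (le_lt_trans (ler_norm _)) // ltrDl.
have := HM _ ML ((x, t), (y, t)) => /= /(_ _); rewrite /= => h.
have {}h := h (ltac:(by split; split; rewrite /= ?in_itv)).
apply: (le_trans h); rewrite ler_wpM2l ?addr_ge0 //.
by rewrite prod_normE /= subrr normr0 ge_max lexx normr_ge0.
Qed.

Lemma lipschitz_osl (r T : R) (u0 v0 : R -> R) (v : R -> R -> R) :
  0 <= T -> Linf_r0 r u0 -> primitive_of u0 v0 ->
  (forall x, v x 0 = v0 x) -> lipschitz_sol T (v_x v) ->
  exists2 M, 0 <= M &
  {ae mu, forall y, {ae mu, forall x, y <= x -> u0 x <= u0 y + M * (x - y)}}.
Proof.
move=> T0 hu0 hv0 vi /lipschitz_solP[L L0 hL]; exists L; first exact: ltW.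
have ev : v ^~ 0 = v0 by apply/funext => x; rewrite -vi.
have h := Linf_primitive_ae_derive hu0 hv0.
apply: ae_imply (h) => y [_ dy]; apply: ae_imply h => x [_ dx] yx.
have := hL x y 0; rewrite lexx T0 => /(_ isT).
rewrite /v_x ev dx dy ler_norml (@ger0_norm _ (x - y)) ?subr_ge0 // => /andP[_].
by rewrite lerBlDl.
Qed.

End initial_data.

(** * One-sided bounds for the difference solution *)

Section LF_bounds.
Variables (R : realType) (H : R -> R -> R -> R) (h : R -> R).
Variables (T r c0 c1 lambda0 lambda1 delta0 c : R) (u0 : R -> R).
Hypotheses (hH : hamiltonian H) (r_gt0 : 0 < r) (c01 : c0 <= c1)
  (hcfl : CFL_constants H h T r c0 c1 lambda1 delta0)
  (hc : c0 <= c <= c1) (hu0 : Linf_r0 r u0).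

Let A := Hxx_star H c0 c1 lambda1.
Let B := Hxp_star H c0 c1 lambda1.
Let C := Hpp_star H c0 c1 lambda1.
Let es := E_star H c0 c1 lambda1.
Let us := ustar H c0 c1 lambda1.
Let lambda1_gt0 : 0 < lambda1 := cfl_lambda1_gt0 hcfl.
Let A0 : 0 <= A. Proof. exact: Hxx_star_ge0. Qed.
Let B0 : 0 <= B. Proof. exact: Hxp_star_ge0. Qed.
Let C0 : 0 < C. Proof. exact: Hpp_star_gt0. Qed.
Let stable := stable_mesh H r c0 c1 lambda0 lambda1 delta0.

Lemma LF_init_bound N K U m : (0 < N)%N -> LF_solution H c u0 N K U ->
  even_node 0 m -> `|U 0%N m| <= r.
Proof.
move=> N0 lf hm; have dx0 := mesh_dx_gt0 R N0.
rewrite (LF_init lf hm) normrM gtr0_norm ?invr_gt0 ?mulr_gt0 //.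
rewrite ler_pdivrMl ?mulr_gt0 //.
apply: le_trans (Linf_Rintegral_le hu0 _) _; first lra.
by rewrite [leRHS]mulrC ler_wpM2l ?(ltW r_gt0) //; lra.
Qed.

Lemma LF_init_osl N K U M : (0 < N)%N -> LF_solution H c u0 N K U -> 0 <= M ->
  {ae (@lebesgue_measure R), forall y,
    {ae (@lebesgue_measure R), forall x, y <= x -> u0 x <= u0 y + M * (x - y)}} ->
  forall m, even_node 0 m -> U 0%N (m + 2) - U 0%N m <= 2 * mesh_dx R N * (2 * M).
Proof.
move=> N0 lf M0 osl m hm; have dx0 := mesh_dx_gt0 R N0.
have hm2 : even_node 0 (m + 2) by rewrite even_nodeD2.
rewrite (LF_init lf hm) (LF_init lf hm2) -mulrBr node_xD2.
set dx := mesh_dx R N in dx0 *; set a := node_x R N m - dx.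
have d0 : 0 < 2 * dx by rewrite mulr_gt0.
have := osl_adjacent hu0 a d0 M0 osl.
have -> : node_x R N m + dx = a + 2 * dx by rewrite /a; ring.
have -> : node_x R N m + 2 * dx - dx = a + 2 * dx by rewrite /a; ring.
have -> : node_x R N m + 2 * dx + dx = a + 2 * dx + 2 * dx by rewrite /a; ring.
move=> h1; rewrite ler_pdivrMl //; lra.
Qed.

Lemma LF_step_bound N K U k m : stable N K -> LF_solution H c u0 N K U ->
  (k < step_of K T)%N -> even_node k m -> `|U k m| <= us.
Proof.
move=> st lf kT hm.
have /andP[_ l1] := stable_ratio st.
have /andP[b1 _] := cfl_bound hcfl (stable_is_mesh st) l1 (stable_dx st) hc hu0 lf kT hm.
exact: (norm_le_ustar hH hc b1).
Qed.

(** The speed bound holds before the last step only, but one step of the scheme carries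
    the slope bound to the next time, so that it reaches [step_of K T] itself. *)
Lemma LF_osl N K U e0 : stable N K -> LF_solution H c u0 N K U ->
  es <= e0 -> mesh_dt R K * C * e0 <= 1 ->
  (forall m, even_node 0 m -> U 0%N (m + 2) - U 0%N m <= 2 * mesh_dx R N * e0) ->
  forall k, (k <= step_of K T)%N -> exists e,
    [/\ es <= e, e <= e0, mesh_dt R K * C * (e - es) * k.+2%:R <= 2 &
      forall m, even_node k m -> U k (m + 2) - U k m <= 2 * mesh_dx R N * e].
Proof.
move=> st lf ese0 he0 init.
have [N0 K0] := is_mesh_pos (stable_is_mesh st).
have dx0 := mesh_dx_gt0 R N0; have dt0 := mesh_dt_gt0 R K0.
have [es0 hB hA] := E_star_stationary A0 B0 C0.
have dC : 0 < mesh_dt R K * C by rewrite mulr_gt0.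
elim=> [_|k IH kT].
  exists e0; split => //.
  have : 0 <= mesh_dt R K * C * es by rewrite mulr_ge0 // ltW.
  by lra.
have [e [ese ee0 hk hU]] := IH (ltnW kT).
have he : mesh_dt R K * C * e <= 1.
  by apply: le_trans he0; rewrite ler_pM2l.
have e_ge0 : 0 <= e by exact: le_trans ese.
have [e' [ese' e'e hk' he']] := riccati_decay C0 dt0 hB hA es0 ese he hk.
exists e'; split => //; first exact: le_trans e'e ee0.
move=> m hm.
have hu m' : even_node k m' -> `|U k m'| <= us by exact: (LF_step_bound st lf kT).
apply: le_trans (LF_osl_step hH lambda1_gt0 c01 hc st lf hu e_ge0 he hU hm) _.
by rewrite ler_pM2l ?mulr_gt0.
Qed.

(** Before any decay the bound is the trivial one: data bounded by [r] have slopes at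
    most [r / dx] on the grid. *)
Lemma LF_osl_decay N K U t : stable N K -> LF_solution H c u0 N K U ->
  0 < t <= T -> forall m, even_node (step_of K t) m ->
  U (step_of K t) (m + 2) - U (step_of K t) m
    <= 2 * mesh_dx R N * (es + 2 / (C * t)).
Proof.
move=> st lf /andP[t0 tT].
have [N0 K0] := is_mesh_pos (stable_is_mesh st).
have dx0 := mesh_dx_gt0 R N0; have dt0 := mesh_dt_gt0 R K0.
have [es0 hB hA] := E_star_stationary A0 B0 C0.
pose e0 := Num.max es (r / mesh_dx R N).
have he0 : mesh_dt R K * C * e0 <= 1.
  rewrite /e0 /Num.max; case: ifP => _; last exact: stable_E st.
  apply: le_trans (stable_r st); rewrite le_eqVlt; apply/orP; left; apply/eqP.
  by rewrite /mesh_lambda -/C; ring.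
have init m : even_node 0 m -> U 0%N (m + 2) - U 0%N m <= 2 * mesh_dx R N * e0.
  move=> hm; have hm2 : even_node 0 (m + 2) by rewrite even_nodeD2.
  have b1 := LF_init_bound N0 lf hm; have b2 := LF_init_bound N0 lf hm2.
  apply: (@le_trans _ _ (2 * mesh_dx R N * (r / mesh_dx R N))); last first.
    by rewrite ler_pM2l ?mulr_gt0 // /e0 le_max lexx orbT.
  have -> : 2 * mesh_dx R N * (r / mesh_dx R N) = 2 * r by field; rewrite gt_eqF.
  by move: b1 b2; rewrite !ler_norml => /andP[] ? ? /andP[]; lra.
have ese0 : es <= e0 by rewrite /e0 le_max lexx.
have [e [ese _ hk hU]] := LF_osl st lf ese0 he0 init (step_of_le K0 tT).
move=> m hm; apply: (le_trans (hU m hm)); rewrite ler_pM2l ?mulr_gt0 //.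
rewrite -lerBlDl ler_pdivlMr ?mulr_gt0 //; apply: le_trans hk.
have /andP[_ t1] := step_of_itv K0 (ltW t0).
have -> : mesh_dt R K * C * (e - es) * (step_of K t).+2%:R =
   (e - es) * (C * (mesh_dt R K * (step_of K t).+2%:R)) by ring.
have tk : t <= mesh_dt R K * (step_of K t).+2%:R.
  by apply: le_trans (ltW t1) _; rewrite mulrC ler_pM2l // ler_nat.
by rewrite ler_wpM2l ?subr_ge0 // ler_pM2l.
Qed.

(** The initial bound is capped by [r / dx], since the recursion must start in the range
    [dt C e <= 1], which the one-sided constant of the data alone need not respect. *)
Lemma LF_osl_uniform N K U t M : stable N K -> LF_solution H c u0 N K U ->
  0 <= M ->
  {ae (@lebesgue_measure R), forall y,
    {ae (@lebesgue_measure R), forall x, y <= x -> u0 x <= u0 y + M * (x - y)}} ->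
  0 <= t <= T -> forall m, even_node (step_of K t) m ->
  U (step_of K t) (m + 2) - U (step_of K t) m
    <= 2 * mesh_dx R N * (es + 2 * M).
Proof.
move=> st lf M0 osl /andP[t0 tT].
have [N0 K0] := is_mesh_pos (stable_is_mesh st).
have dx0 := mesh_dx_gt0 R N0; have dt0 := mesh_dt_gt0 R K0.
have [es0 hB hA] := E_star_stationary A0 B0 C0.
pose e0 := Num.max es (Num.min (r / mesh_dx R N) (2 * M)).
have he0 : mesh_dt R K * C * e0 <= 1.
  rewrite /e0 /Num.max; case: ifP => _; last exact: stable_E st.
  apply: (@le_trans _ _ (mesh_dt R K * C * (r / mesh_dx R N))).
    by rewrite ler_pM2l ?mulr_gt0 // ge_min lexx.
  apply: le_trans (stable_r st); rewrite le_eqVlt; apply/orP; left; apply/eqP.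
  by rewrite /mesh_lambda -/C; ring.
have init m : even_node 0 m -> U 0%N (m + 2) - U 0%N m <= 2 * mesh_dx R N * e0.
  move=> hm; have hm2 : even_node 0 (m + 2) by rewrite even_nodeD2.
  have b1 := LF_init_bound N0 lf hm; have b2 := LF_init_bound N0 lf hm2.
  have b3 := LF_init_osl N0 lf M0 osl hm.
  apply: (@le_trans _ _ (2 * mesh_dx R N * Num.min (r / mesh_dx R N) (2 * M))); last first.
    by rewrite ler_pM2l ?mulr_gt0 // /e0 le_max lexx orbT.
  rewrite /Num.min; case: ifP => // _.
  have -> : 2 * mesh_dx R N * (r / mesh_dx R N) = 2 * r by field; rewrite gt_eqF.
  by move: b1 b2; rewrite !ler_norml => /andP[] ? ? /andP[]; lra.
have ese0 : es <= e0 by rewrite /e0 le_max lexx.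
have [e [_ ee0 _ hU]] := LF_osl st lf ese0 he0 init (step_of_le K0 tT).
move=> m hm; apply: (le_trans (hU m hm)); rewrite ler_pM2l ?mulr_gt0 //.
apply: (le_trans ee0); rewrite /e0 ge_max lerDl ge_min.
by rewrite mulr_ge0 //= orbC lerDr es0.
Qed.

End LF_bounds.

(** * The scheme for the primitive *)

Section HJ_grid.
Variables (R : realType) (H : R -> R -> R -> R) (c hc : R) (v0 : R -> R) (N K : nat).

(** Defined on all integers; the two parity classes do not interact. *)
Fixpoint HJ_grid (k : nat) : int -> R :=
  if k is k'.+1 then fun j =>
    let V := HJ_grid k' in
    (V (j - 1) + V (j + 1)) / 2 - mesh_dt R K *
      (H (node_x R N j) (node_t R K k')
         (c + (V (j + 1) - V (j - 1)) / (2 * mesh_dx R N)) - hc)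
  else fun j => v0 (node_x R N j).

Definition HJ_slope (k : nat) (m : int) : R :=
  (HJ_grid k (m + 1) - HJ_grid k (m - 1)) / (2 * mesh_dx R N).

Lemma HJ_gridS k j : HJ_grid k.+1 j =
  (HJ_grid k (j - 1) + HJ_grid k (j + 1)) / 2 - mesh_dt R K *
    (H (node_x R N j) (node_t R K k) (c + HJ_slope k j) - hc).
Proof. by []. Qed.

Lemma intDAC (a b d : int) : a + b + d = a + d + b. Proof. by rewrite addrAC. Qed.

Lemma HJ_grid_periodic : periodic1 H -> periodic1 v0 -> (0 < N)%N ->
  forall k m, HJ_grid k (m + (2 * N)%:Z) = HJ_grid k m.
Proof.
move=> pH pv N0; elim=> [|k IH] m /=.
  by rewrite node_x_period // pv.
rewrite (intDAC m _ (-1)) (intDAC m _ 1) !IH node_x_period // pH; reflexivity.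
Qed.

Lemma HJ_grid_solution : periodic1 H -> periodic1 v0 -> is_mesh N K ->
  HJ_solution H c hc v0 N K HJ_grid.
Proof.
move=> pH pv /is_mesh_pos[N0 K0].
have dt0 := mesh_dt_gt0 R K0.
split => //; last by move=> k m _; exact: HJ_grid_periodic.
move=> k m _ /=; set S := (_ + _) / 2; set X := H _ _ _.
rewrite (_ : S - mesh_dt R K * (X - hc) - S = mesh_dt R K * (hc - X)); last ring.
by rewrite [mesh_dt R K * _]mulrC mulfK ?gt_eqF // subrK.
Qed.

Lemma HJ_slope_LF (u0 : R -> R) : periodic1 H -> primitive_of u0 v0 ->
  is_mesh N K -> LF_solution H c u0 N K HJ_slope.
Proof.
move=> pH [pv hv] /is_mesh_pos[N0 K0].
have dt0 := mesh_dt_gt0 R K0; have dx0 := mesh_dx_gt0 R N0.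
split.
- move=> k m _.
  have e1 : m + 1 + 1 = m + 2 by rewrite -addrA.
  have e2 : m + 2 - 1 = m + 1 by rewrite -addrA.
  have -> : HJ_slope k.+1 (m + 1) =
      (HJ_grid k.+1 (m + 2) - HJ_grid k.+1 m) / (2 * mesh_dx R N).
    by rewrite /HJ_slope e1 addrK.
  rewrite !HJ_gridS e2.
  set X2 := H (node_x R N (m + 2)) _ _; set X1 := H (node_x R N m) _ _.
  rewrite /HJ_slope e2; clearbody X1 X2.
  by field; rewrite !gt_eqF.
- by move=> k m _; rewrite /HJ_slope (intDAC m _ (-1)) (intDAC m _ 1) !HJ_grid_periodic.
- move=> m _; rewrite /HJ_slope /= node_xD1 node_xB1 hv; first by rewrite mulrC.
  lra.
Qed.

End HJ_grid.

Lemma LF_unique (R : realType) (H : R -> R -> R -> R) c u0 N K (U W : nat -> int -> R) :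
  (0 < K)%N -> LF_solution H c u0 N K U -> LF_solution H c u0 N K W ->
  forall k m, even_node k m -> U k m = W k m.
Proof.
move=> K0 hU hW; have dt0 := mesh_dt_gt0 R K0.
elim=> [|k IH] m hm; first by rewrite (LF_init hU hm) (LF_init hW hm).
have hm1 : even_node k (m - 1) by rewrite -even_nodeSD1 subrK.
have hm2 : even_node k (m - 1 + 2) by rewrite even_nodeD2.
have := LF_scheme hU hm1; have := LF_scheme hW hm1.
rewrite subrK (IH _ hm1) (IH _ hm2) => <- /addIr/(mulIf _) => h.
apply: (addIr _ (h _)); by rewrite invr_eq0 gt_eqF.
Qed.

(** * Piecewise linear interpolation *)

Section interpolation.
Variables (R : realType) (N k : nat).
Hypothesis N_gt0 : (0 < N)%N.
Local Notation dx := (mesh_dx R N).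
Let dx0 : 0 < dx := mesh_dx_gt0 R N_gt0.

Lemma even_cell_of (x : R) : even_node k (cell_of N k x).
Proof. rewrite /even_node /cell_of; set f := Num.floor _; clearbody f; clear; lia. Qed.

Lemma cell_of_itv (x : R) :
  node_x R N (cell_of N k x - 1) <= x < node_x R N (cell_of N k x + 1).
Proof.
set f := Num.floor ((x / dx + 1 - k%:R) / 2).
have /andP[f1 f2] := Num.Theory.floor_itv ((x / dx + 1 - k%:R) / 2).
rewrite -/f intrD in f1 f2.
rewrite node_xB1 node_xD1 /node_x /cell_of -/f intrD intrM -pmulrn.
have -> : (2 : int)%:~R = 2 :> R by [].
rewrite ler_pdivlMr // in f1; rewrite ltr_pdivrMr // in f2.
set q : R := x / dx in f1 f2.
have -> : x = q * dx by rewrite /q divfK // gt_eqF.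
have -> : (2 * f%:~R + k%:R) * dx - dx = (2 * f%:~R + k%:R - 1) * dx by ring.
have -> : (2 * f%:~R + k%:R) * dx + dx = (2 * f%:~R + k%:R + 1) * dx by ring.
by rewrite ler_pM2r // ltr_pM2r //; apply/andP; split; lra.
Qed.

Lemma cell_of_period (x : R) :
  cell_of N k (x + 1) = cell_of N k x + (2 * N)%:Z.
Proof.
rewrite /cell_of.
have -> : ((x + 1) / mesh_dx R N + 1 - k%:R) / 2 =
    (x / mesh_dx R N + 1 - k%:R) / 2 + (N%:Z)%:~R.
  by rewrite /mesh_dx invrK natrM -pmulrn; field.
by rewrite floorDrz ?intr_int // intrKfloor mulrDr addrAC PoszM.
Qed.

Lemma quadratic_growth (W : nat -> R) (D : R) : W 0%N <= 0 ->
  (forall i, W i.+1 <= W i + i%:R * D) ->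
  forall n, W n <= D * (n%:R * (n%:R - 1) / 2).
Proof.
move=> W0 WS; elim=> [|n IH]; first by rewrite mul0r mul0r mulr0.
by apply: (le_trans (WS n)); rewrite -natr1; lra.
Qed.

Variables (U V : int -> R) (M : R).
Hypothesis M0 : 0 <= M.
Hypothesis UV : forall m, even_node k m -> V (m + 1) - V (m - 1) = 2 * dx * U m.
Hypothesis osl : forall m, even_node k m -> U (m + 2) - U m <= 2 * dx * M.

Definition interp (x : R) : R :=
  let m := cell_of N k x in
  V (m - 1) + (V (m + 1) - V (m - 1)) / (2 * dx) * (x - node_x R N (m - 1)).

Lemma osl_iter m (i : nat) : even_node k m ->
  U (m + 2 * i%:Z) - U m <= i%:R * (2 * dx * M).
Proof.
move=> hm; elim: i => [|i IH]; first by rewrite mulr0 addr0 subrr mul0r.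
have hmi : even_node k (m + 2 * i%:Z) by move: hm; clear; rewrite /even_node; lia.
have := osl hmi.
have -> : m + 2 * i%:Z + 2 = m + 2 * i.+1%:Z by clear; lia.
by rewrite -natr1; lra.
Qed.

Lemma interp_lin x : let m := cell_of N k x in
  interp x = V (m - 1) + U m * (x - node_x R N (m - 1)).
Proof.
move=> m; rewrite /interp -/m UV ?even_cell_of // [2 * dx * U m]mulrC mulfK //.
by rewrite gt_eqF // mulr_gt0.
Qed.

Lemma interp_lin_r x : let m := cell_of N k x in
  interp x = V (m + 1) - U m * (node_x R N (m + 1) - x).
Proof.
move=> m; rewrite interp_lin -/m.
have := UV (even_cell_of x); rewrite -/m node_xB1 node_xD1; lra.
Qed.

Lemma node_xD2i m (i : nat) : node_x R N (m + 2 * i%:Z) = node_x R N m + i%:R * (2 * dx).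
Proof.
rewrite node_xD intrM -pmulrn.
have -> : (2 : int)%:~R = 2 :> R by [].
by rewrite mulrA [2 * i%:R]mulrC.
Qed.

Lemma node_xB2i m (i : nat) : node_x R N (m - 2 * i%:Z) = node_x R N m - i%:R * (2 * dx).
Proof. by rewrite -[in RHS](subrK (2 * i%:Z) m) node_xD2i addrK. Qed.

(** Adds up the growth over [n] cells of width [D] and a remainder [s]. *)
Lemma interp_bound_alg (D w s n e : R) : 0 <= M -> 0 < D -> 1 <= n -> 0 <= s ->
  (n - 1) * D + s <= w -> e <= D * D * M * (n * (n - 1) / 2) + n * (D * M) * s ->
  e <= M * w * (w + D).
Proof.
move=> M0' D0 n1 s0 hw he; apply: (le_trans he).
have k1 : 0 <= (n - 1) * D by rewrite mulr_ge0 ?subr_ge0 // ltW.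
have : ((n - 1) * D + s) * (n * D + s) <= w * (w + D).
  by apply: ler_pM; lra.
have k2 : 0 <= (n * D) * ((n - 1) * D) by rewrite mulr_ge0 // mulr_ge0 //; lra.
have k3 : 0 <= (n - 1) * D * s by rewrite mulr_ge0.
have k4 : 0 <= s * s by rewrite mulr_ge0.
move=> h; have hM := ler_wpM2l M0' h.
rewrite -[M * w * _]mulrA; apply: le_trans hM.
have -> : D * D * M * (n * (n - 1) / 2) + n * (D * M) * s =
  M * (n * D * ((n - 1) * D) / 2 + n * D * s) by field.
by rewrite ler_wpM2l //; lra.
Qed.

(** Slopes grow by at most [2 dx M] from a cell to the next one on the right, so moving
    away from [x] in either direction the graph stays below the line of slope [U] through
    the point over [x], up to a quadratic error. *)
Lemma interp_le x y :
  interp y - interp x <= U (cell_of N k x) * (y - x)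
    + M * `|y - x| * (`|y - x| + 2 * dx).
Proof.
set m := cell_of N k x; have hm : even_node k m by exact: even_cell_of.
set m' := cell_of N k y; have hm' : even_node k m' by exact: even_cell_of.
have /andP[x1 x2] := cell_of_itv x; have /andP[y1 y2] := cell_of_itv y.
rewrite -/m in x1 x2; rewrite -/m' in y1 y2.
have D0 : 0 < 2 * dx by rewrite mulr_gt0.
have rhs0 : 0 <= M * `|y - x| * (`|y - x| + 2 * dx).
  by rewrite mulr_ge0 ?mulr_ge0 // addr_ge0 // ltW.
have [n mn] : exists n : int, m' = m + 2 * n.
  exists ((m' - m) %/ 2)%Z; move: hm hm'; clear; rewrite /even_node; lia.
case: n mn => [[|p]|p] mn.
  (* In a common cell the interpolant is affine. *)
- rewrite !interp_lin -/m -/m' mn mulr0 addr0 -subr_ge0.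
  by rewrite (_ : _ - _ = M * `|y - x| * (`|y - x| + 2 * dx)) //; ring.
  (* [W i] is the height above the line after [i] cells to the right. *)
- set n := p.+1 in mn.
  pose W (i : nat) := V (m - 1 + 2 * i%:Z) - (V (m - 1) + U m * (i%:R * (2 * dx))).
  have Wn : W n <= 2 * dx * (2 * dx) * M * (n%:R * (n%:R - 1) / 2).
    apply: quadratic_growth; first by rewrite /W mulr0 !mul0r mulr0 !addr0 subrr.
    move=> i; have hmi : even_node k (m + 2 * i%:Z) by move: hm; clear; rewrite /even_node; lia.
    have := UV hmi; have := osl_iter i hm; rewrite /W.
    have -> : m + 2 * i%:Z + 1 = m - 1 + 2 * i.+1%:Z by clear; lia.
    have -> : m + 2 * i%:Z - 1 = m - 1 + 2 * i%:Z by clear; lia.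
    rewrite -natr1 => h1 h2.
    have := ler_wpM2l (ltW D0) h1.
    by rewrite mulrBr -h2; lra.
  have hU := osl_iter n hm.
  set s := y - node_x R N (m' - 1).
  have s0 : 0 <= s by rewrite subr_ge0.
  have ym : node_x R N (m' - 1) = node_x R N (m - 1) + n%:R * (2 * dx).
    by rewrite -node_xD2i; congr (node_x R N _); rewrite mn; clear; lia.
  have hw : (n%:R - 1) * (2 * dx) + s <= `|y - x|.
    apply: le_trans (ler_norm _); rewrite /s ym.
    by move: x2; rewrite node_xB1 node_xD1; lra.
  have n1 : 1 <= n%:R :> R by rewrite ler1n.
  rewrite -lerBlDl; apply: (interp_bound_alg M0 D0 n1 s0 hw).
  have hUs := ler_wpM2r s0 hU.
  rewrite !interp_lin -/m -/m' -/s.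
  have eV : V (m' - 1) = W n + (V (m - 1) + U m * (n%:R * (2 * dx))).
    rewrite /W [m - 1 + _](_ : _ = m' - 1) ?subrK //; rewrite mn; clear; lia.
  rewrite eV -mn in hUs *.
  have -> : y = node_x R N (m - 1) + n%:R * (2 * dx) + s by rewrite -ym /s addrC subrK.
  rewrite mulrBl in hUs.
  by lra.
  (* The same on the left, with the line anchored at the right end of the cell. *)
- set n := p.+1.
  have mn' : m' = m - 2 * n%:Z by rewrite mn /n; clear; lia.
  pose W (i : nat) := V (m + 1 - 2 * i%:Z) - (V (m + 1) - U m * (i%:R * (2 * dx))).
  have hUi i : U m - U (m - 2 * i%:Z) <= i%:R * (2 * dx * M).
    have hmi : even_node k (m - 2 * i%:Z) by move: hm; clear; rewrite /even_node; lia.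
    by have := osl_iter i hmi; rewrite subrK.
  have Wn : W n <= 2 * dx * (2 * dx) * M * (n%:R * (n%:R - 1) / 2).
    apply: quadratic_growth; first by rewrite /W mulr0 !mul0r mulr0 !subr0 subrr.
    move=> i; have hmi : even_node k (m - 2 * i%:Z) by move: hm; clear; rewrite /even_node; lia.
    have := UV hmi; have := hUi i; rewrite /W.
    have -> : m - 2 * i%:Z + 1 = m + 1 - 2 * i%:Z by clear; lia.
    have -> : m - 2 * i%:Z - 1 = m + 1 - 2 * i.+1%:Z by clear; lia.
    rewrite -natr1 => h1 h2.
    have := ler_wpM2l (ltW D0) h1.
    by rewrite mulrBr -h2; lra.
  have hU := hUi n.
  set s := node_x R N (m' + 1) - y.
  have s0 : 0 <= s by rewrite subr_ge0 ltW.
  have ym : node_x R N (m' + 1) = node_x R N (m + 1) - n%:R * (2 * dx).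
    by rewrite -node_xB2i; congr (node_x R N _); rewrite mn'; clear; lia.
  have hw : (n%:R - 1) * (2 * dx) + s <= `|y - x|.
    rewrite distrC; apply: le_trans (ler_norm _); rewrite /s ym.
    by move: x1; rewrite node_xB1 node_xD1; lra.
  have n1 : 1 <= n%:R :> R by rewrite ler1n.
  rewrite -lerBlDl; apply: (interp_bound_alg M0 D0 n1 s0 hw).
  rewrite -mn' in hU.
  have hUs := ler_wpM2r s0 hU.
  rewrite !interp_lin_r -/m -/m' -/s.
  have eV : V (m' + 1) = W n + (V (m + 1) - U m * (n%:R * (2 * dx))).
    rewrite /W [m + 1 - _](_ : _ = m' + 1) ?subrK //; rewrite mn'; clear; lia.
  rewrite eV.
  have -> : y = node_x R N (m + 1) - n%:R * (2 * dx) - s by rewrite -ym /s opprB addrC subrK.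
  rewrite mulrBl in hUs.
  by lra.
Qed.

End interpolation.

(** * Semiconcave functions *)

Section semiconcave.
Variable R : realType.

(** [f - M x^2] is concave, written with chord slopes of [f]. *)
Definition semiconcave (M : R) (f : R -> R) : Prop := forall x y z, x < y -> y < z ->
  (f z - f y) / (z - y) - (f y - f x) / (y - x) <= M * (z - x).

(** The chord slopes at [x], of width [h], of the concave function [y |-> f y - M (y - x)^2];
    they bracket its supergradients at [x]. *)
Definition lower_slope (M : R) (f : R -> R) (h x : R) := (f (x + h) - f x) / h - M * h.
Definition upper_slope (M : R) (f : R -> R) (h x : R) := (f x - f (x - h)) / h + M * h.

Variables (M : R) (f : R -> R).
Hypothesis M0 : 0 <= M.
Hypothesis sc : semiconcave M f.
Local Notation lo := (lower_slope M f).
Local Notation up := (upper_slope M f).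

Lemma lower_slope_mono x s h : 0 < s -> s <= h -> lo h x <= lo s x.
Proof.
move=> s0; rewrite le_eqVlt => /predU1P[->//|sh].
have xs : x < x + s by rewrite ltrDl.
have xh : x + s < x + h by rewrite ltrD2l.
have := sc xs xh.
have -> : x + h - (x + s) = h - s by ring.
have -> : x + s - x = s by ring.
have -> : x + h - x = h by ring.
have h0 : 0 < h by exact: lt_trans sh.
have hs : 0 < h - s by rewrite subr_gt0.
rewrite lerBlDr ler_pdivrMr //.
set a := f (x + h); set b := f (x + s) => H1.
rewrite /lower_slope -/a -/b.
rewrite lerBlDr ler_pdivrMr //.
set q := (b - f x) / s in H1 *.
have e : b - f x = q * s by rewrite /q divfK // gt_eqF.
nra.
Qed.

Lemma upper_slope_mono x s h : 0 < s -> s <= h -> up s x <= up h x.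
Proof.
move=> s0; rewrite le_eqVlt => /predU1P[->//|sh].
have xs : x - s < x by rewrite gtrBl.
have xh : x - h < x - s by rewrite ltrD2l ltrN2.
have := sc xh xs.
have -> : x - s - (x - h) = h - s by ring.
have -> : x - (x - s) = s by ring.
have -> : x - (x - h) = h by ring.
have h0 : 0 < h by exact: lt_trans sh.
have hs : 0 < h - s by rewrite subr_gt0.
rewrite lerBlDr -lerBlDl ler_pdivlMr //.
set a := f (x - h); set b := f (x - s) => H1.
rewrite /upper_slope -/a -/b -lerBlDr ler_pdivlMr //.
set q := (f x - b) / s in H1 *.
have e : f x - b = q * s by rewrite /q divfK // gt_eqF.
nra.
Qed.

Lemma lower_le_upper x s h : 0 < s -> 0 < h -> lo s x <= up h x.
Proof.
move=> s0 h0.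
have xs : x < x + s by rewrite ltrDl.
have xh : x - h < x by rewrite gtrBl.
have := sc xh xs.
have -> : x + s - x = s by ring.
have -> : x - (x - h) = h by ring.
rewrite /lower_slope /upper_slope => h1; lra.
Qed.

Lemma quotient_between x h s : 0 < h -> s != 0 -> `|s| <= h ->
  lo h x - M * h <= (f (x + s) - f x) / s <= up h x + M * h.
Proof.
move=> h0 sn sh; have Mh : 0 <= M * h by rewrite mulr_ge0 // ltW.
have [s0|] := ltP 0 s.
  rewrite gtr0_norm // in sh.
  have := lower_slope_mono x s0 sh; have := lower_le_upper x s0 h0.
  have Ms : 0 <= M * s by rewrite mulr_ge0 // ltW.
  have Msh : M * s <= M * h by rewrite ler_wpM2l.
  rewrite {1 3}/lower_slope => h1 h2; apply/andP; split; lra.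
rewrite le_eqVlt (negbTE sn) /= => s0.
rewrite ltr0_norm // in sh.
have s0' : 0 < - s by rewrite oppr_gt0.
have := upper_slope_mono x s0' sh; have := lower_le_upper x h0 s0'.
have Ms : 0 <= M * - s by rewrite mulr_ge0 // ltW.
have Msh : M * - s <= M * h by rewrite ler_wpM2l.
have e : (f x - f (x + s)) / - s = (f (x + s) - f x) / s.
  by rewrite -[f x - _]opprB invrN mulrNN.
rewrite {1 2}/upper_slope opprK e => h1 h2; apply/andP; split; lra.
Qed.

(** The lower slopes increase and the upper ones decrease as the width shrinks, so a
    vanishing gap leaves a single limit. *)
Lemma regular_of_gap x :
  (forall e, 0 < e -> exists2 h, 0 < h & up h x - lo h x <= e) ->
  derivable f x 1.
Proof.
move=> gap.
pose l := sup [set lo h x | h in [set h | 0 < h]].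
have lu h : 0 < h -> lo h x <= l.
  move=> h0; apply: ub_le_sup; last by exists h.
  by exists (up 1 x) => _ [s s0 <-]; exact: (lower_le_upper x s0 ltr01).
have ul h : 0 < h -> l <= up h x.
  move=> h0; apply: ge_sup; first by exists (lo 1 x), 1; [exact: ltr01|].
  by move=> _ [s s0 <-]; exact: (lower_le_upper x s0 h0).
suff hd : is_derive x (1 : R) f l by exact: (@ex_derive _ _ _ _ _ _ _ hd).
apply: derive1_of_quotient => e e0.
have e20 : 0 < e / 2 by rewrite divr_gt0.
have [h1 h10 g1] := gap _ e20.
pose h := Num.min h1 (e / (2 * (M + 1))).
have M1 : 0 < M + 1 by rewrite ltr_wpDl.
have h0 : 0 < h by rewrite /h lt_min h10 /= divr_gt0 // mulr_gt0.
have hh1 : h <= h1 by rewrite /h ge_min lexx.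
have Mh : M * h <= e / 2.
  have : h <= e / (2 * (M + 1)) by rewrite /h ge_min lexx orbT.
  rewrite ler_pdivlMr ?mulr_gt0 // => hb.
  lra.
exists h => // s sn sh.
have := quotient_between x h0 sn (ltW sh) => /andP[q1 q2].
have := lu h h0; have := ul h h0.
have := lower_slope_mono x h0 hh1; have := upper_slope_mono x h0 hh1.
rewrite ler_norml => *; apply/andP; split; lra.
Qed.

Lemma regular_between x h : derivable f x 1 -> 0 < h ->
  lo h x <= derive1 f x <= up h x.
Proof.
move=> dx h0; have hd := derivable_is_derive1 dx; set l := derive1 f x in hd *.
have cv := @ex_derive _ _ _ _ _ _ _ hd.
have lim : forall e, 0 < e -> exists d, [/\ 0 < d, d <= h, `|(f (x + d) - f x) / d - l| <= e
    & `|(f x - f (x - d)) / d - l| <= e].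
  move=> e e0.
  have /cvgrPdist_le/(_ e e0) : (fun h => h^-1 *: ((f \o shift x) (h *: (1 : R)) - f x)) @ 0^' --> l.
    have <- : 'D_1 f x = l by exact: (@derive_val _ _ _ _ _ _ _ hd).
    exact: cv.
  move=> [/= r r0 hr].
  pose d := Num.min h (r / 2).
  have d0 : 0 < d by rewrite /d lt_min h0 /= divr_gt0.
  have dr : d < r.
    apply: (@le_lt_trans _ _ (r / 2)); first by rewrite /d ge_min lexx orbT.
    by rewrite gtr_pMr // invf_lt1 // ltr1n.
  have dh : d <= h by rewrite /d ge_min lexx.
  have q s : s != 0 -> `|s| < r -> `|(f (x + s) - f x) / s - l| <= e.
    move=> sn sr; have := hr s; rewrite /ball_ /= sub0r normrN => /(_ sr sn).
    by rewrite distrC /GRing.scale /= mulr1 [s + x]addrC mulrC.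
  exists d; split => //; first by apply: q; rewrite ?gt_eqF // gtr0_norm.
  have := q (- d); rewrite oppr_eq0 gt_eqF // normrN gtr0_norm // => /(_ isT dr).
  by rewrite -[f x - _]opprB mulNr -mulrN -invrN.
apply/andP; split; apply/ler_addgt0Pr => e e0;
  have [d [d0 dh q1 q2]] := lim e e0; have Md : 0 <= M * d by rewrite mulr_ge0 // ltW.
- have := lower_slope_mono x d0 dh; rewrite {2}/lower_slope.
  by move: q1; rewrite ler_norml => /andP[]; lra.
- have := upper_slope_mono x d0 dh; rewrite {1}/upper_slope.
  by move: q2; rewrite ler_norml => /andP[]; lra.
Qed.

End semiconcave.

(** * Integrals over a period *)

Section integral_bound.
Variable R : realType.
Local Notation mu := (@lebesgue_measure R).

(** The derivative of a semiconcave function takes arbitrary values at the kinks, so [g] is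
    any function: raising [F] to [+oo] on the exceptional null set makes the inequality
    hold everywhere without changing the integral of [F], and integrals of nonnegative
    functions are monotone by definition. *)
Lemma ge0_integral_le_ae (D : set R) (g F : R -> \bar R) : measurable D ->
  (forall x, (0 <= g x)%E) -> (forall x, (0 <= F x)%E) -> measurable_fun D F ->
  {ae mu, forall x, D x -> (g x <= F x)%E} ->
  (\int[mu]_(x in D) g x <= \int[mu]_(x in D) F x)%E.
Proof.
move=> mD g0 F0 mF [A [mA A0 hA]].
pose F' x := if x \in A then +oo%E else F x.
have F'0 x : (0 <= F' x)%E by rewrite /F'; case: ifP.
have mF' : measurable_fun D F'.
  apply: measurable_fun_if => //.
  - apply: (measurable_fun_bool true).
    rewrite (_ : _ @^-1` _ = A); first exact: measurableI.
    by apply/seteqP; split => x; [exact: set_mem | exact: mem_set].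
  - exact: measurable_funS mF.
have -> : (\int[mu]_(x in D) F x = \int[mu]_(x in D) F' x)%E.
  apply: ge0_ae_eq_integral => //.
  exists A; split => // x /= nF; apply: contrapT => nA; apply: nF => _.
  by rewrite /F' memNset.
rewrite !ge0_integralE //; apply: ereal_sup_le => _ [s /= hs <-].
exists s => // x; apply: (le_trans (hs x)).
rewrite !patchE; case: ifP => // xD.
rewrite /F'; case: ifPn => [_|xA]; first exact: leey.
apply: contrapT => ng; move: xA; rewrite notin_setE; apply.
apply: hA => /= h; apply: ng; apply: h; exact: set_mem.
Qed.

Lemma continuous_antiderivative (f : R -> R) (a : R) : continuous f ->
  exists Phi, forall x, a < x -> is_derive x (1 : R) Phi (f x).
Proof.
move=> cf; exists (fun x => \int[mu]_(t in `[a, x]) f t) => x ax.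
have xx1 : x < x + 1 by rewrite ltrDl.
have intf : mu.-integrable `[a, x + 1] (EFin \o f).
  apply: continuous_compact_integrable; first exact: segment_compact.
  exact: continuous_subspaceT.
have [d1 d2] := continuous_FTC1_closed xx1 intf ax (cf x).
by rewrite -d2; exact: derivable_is_derive1.
Qed.

Lemma is_derive_0_cst_right (b : R) (g : R -> R) :
  (forall x, b < x -> is_derive x (1 : R) g 0) ->
  forall x y, b < x -> b < y -> g x = g y.
Proof.
move=> dg x y; wlog xy : x y / x <= y.
  by move=> W bx yb; have [xy|/ltW yx] := leP x y; [exact: W|exact/esym/W].
move=> bx yb.
have cg : {within `[x, y], continuous g}.
  apply: continuous_in_subspaceT => z; rewrite inE /= in_itv /= => /andP[xz _].
  apply: differentiable_continuous; apply/derivable1_diffP.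
  exact: (@ex_derive _ _ _ _ _ _ _ (dg z (lt_le_trans bx xz))).
have dg' z : z \in `]x, y[ -> is_derive z (1 : R) g ((fun=> 0) z).
  by rewrite in_itv /= => /andP[xz _]; apply: dg; exact: lt_trans xz.
have [z _] := MVT_segment xy dg' cg.
by rewrite mul0r => /eqP; rewrite subr_eq0 => /eqP.
Qed.

Variables (M : R) (f : R -> R).
Hypothesis M0 : 0 <= M.
Hypothesis sc : semiconcave M f.
Hypothesis cf : continuous f.
Hypothesis pf : periodic1 f.
Local Notation gap h x := (upper_slope M f h x - lower_slope M f h x).

Lemma gapE h x : gap h x = (2 * f x - f (x - h) - f (x + h)) / h + 2 * M * h.
Proof. by rewrite /upper_slope /lower_slope; ring. Qed.

Lemma gap_ge0 h x : 0 < h -> 0 <= gap h x.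
Proof. by move=> h0; rewrite subr_ge0; exact: (lower_le_upper sc). Qed.

Lemma gap_continuous h : continuous (fun x => gap h x).
Proof.
have -> : (fun x => gap h x) =
    (fun x => (2 * f x - f (x - h) - f (x + h)) / h + 2 * M * h).
  by apply/funext => x; exact: gapE.
move=> x.
have cm : {for x, continuous (fun y => f (y - h))}.
  by apply: continuous_comp; [apply: cvgB; [exact: cvg_id|exact: cvg_cst]|exact: cf].
have cp : {for x, continuous (fun y => f (y + h))}.
  by apply: continuous_comp; [apply: cvgD; [exact: cvg_id|exact: cvg_cst]|exact: cf].
apply: cvgD; last exact: cvg_cst.
apply: cvgM; last exact: cvg_cst.
apply: cvgB; last exact: cp.
apply: cvgB; last exact: cm.
by apply: cvgM; [exact: cvg_cst|exact: cf].
Qed.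

(** Translating a periodic function does not change its integral over a period, so only
    the [M h] terms of the gap contribute. The translation is done on an antiderivative,
    whose increment over a period is constant. *)
Lemma gap_integral h (a : R) : 0 < h ->
  (\int[mu]_(x in `[a, (a + 1)%R]) (gap h x)%:E = (2 * M * h)%:E)%E.
Proof.
move=> h0.
have [Phi dPhi] := continuous_antiderivative (a - h - 1) cf.
pose Psi x := (2 * Phi x - Phi (x - h) - Phi (x + h)) / h + 2 * M * h * x.
have dshift (s x : R) : a - h - 1 < x + s ->
    is_derive x (1 : R) (fun y => Phi (y + s)) (f (x + s)).
  move=> xs.
  have := @is_derive1_comp _ Phi (fun y => y + s) x (f (x + s)) 1 (dPhi _ xs).
  rewrite mulr1; apply.
  by apply: is_derive_eq; rewrite addr0.
have dPsi x : a - 1 < x -> is_derive x (1 : R) Psi (gap h x).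
  move=> ax.
  have d1 := dPhi x (ltac:(lra)).
  have d2 := dshift (- h) x (ltac:(lra)).
  have d3 := dshift h x (ltac:(lra)).
  rewrite gapE /Psi; apply: is_derive_eq.
  by rewrite /GRing.scale /=; ring.
have dder x : a - 1 < x -> derivable Psi x 1.
  by move=> ax; exact: (@ex_derive _ _ _ _ _ _ _ (dPsi x ax)).
have cPsi x : a - 1 < x -> {for x, continuous Psi}.
  by move=> ax; apply: differentiable_continuous; apply/derivable1_diffP; exact: dder.
have Phi1 (x : R) : a - h - 1 < x -> Phi (x + 1) - Phi x = Phi (a + 1) - Phi a.
  move=> ax.
  apply: (@is_derive_0_cst_right (a - h - 1) (fun z => Phi (z + 1) - Phi z)) => //; last by lra.
  move=> y ay; have d1 := dshift 1 y (ltac:(lra)); have d2 := dPhi y ay.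
  by apply: is_derive_eq; rewrite pf subrr.
rewrite (@continuous_FTC2 _ _ Psi); first last.
- by move=> x; rewrite in_itv /= => /andP[ax _]; rewrite derive1E; apply: (@derive_val _ _ _ _ _ _ _ (dPsi x _)); lra.
- split.
  + by move=> x; rewrite in_itv /= => /andP[ax _]; apply: dder; lra.
  + by apply: cvg_at_right_filter; apply: cPsi; lra.
  + by apply: cvg_at_left_filter; apply: cPsi; lra.
- by apply: continuous_subspaceT; exact: gap_continuous.
- by rewrite ltrDl.
rewrite -EFinB; congr (_%:E); rewrite /Psi.
have e1 := Phi1 (a - h) (ltac:(lra)); have e2 := Phi1 (a + h) (ltac:(lra)).
have e3 : a + 1 - h = a - h + 1 by ring.
have e4 : a + 1 + h = a + h + 1 by ring.
rewrite e3 e4.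
have -> : Phi (a - h + 1) = Phi (a - h) + (Phi (a + 1) - Phi a) by rewrite -e1; ring.
have -> : Phi (a + h + 1) = Phi (a + h) + (Phi (a + 1) - Phi a) by rewrite -e2; ring.
by ring.
Qed.

End integral_bound.

(** * Comparing derivatives of semiconcave functions *)

Section regular_points.
Variable R : realType.
Local Notation mu := (@lebesgue_measure R).
Variables (M : R) (f : R -> R).
Hypothesis M0 : 0 <= M.
Hypothesis sc : semiconcave M f.
Hypothesis cf : continuous f.
Hypothesis pf : periodic1 f.
Local Notation gap h x := (upper_slope M f h x - lower_slope M f h x).

Lemma gap_measurable (D : set R) h : measurable_fun D (fun x => (gap h x)%:E).
Proof.
apply/measurable_EFinP; apply: measurable_funTS.
by apply: continuous_measurable_fun; exact: gap_continuous.
Qed.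

(** Markov's inequality. *)
Lemma gap_superlevel (a h e : R) : 0 < h -> 0 < e ->
  (mu (`[a, (a + 1)%R] `&` [set x | (e%:E <= `|(gap h x)%:E|)%E])
     <= (2 * M * h / e)%:E)%E.
Proof.
move=> h0 e0.
have mD : measurable (`[a, (a + 1)%R]%classic : set R) by exact: measurable_itv.
have := @le_integral_comp_abse _ _ R mu _ mD (fun x => (gap h x)%:E) e id
  (@measurable_id _ _ _) (fun r r0 => r0) (fun x y _ _ xy => xy) (@gap_measurable _ h) e0.
rewrite (_ : (\int[mu]_(x in `[a, (a + 1)%R]) id `|(gap h x)%:E|)%E = (2 * M * h)%:E); last first.
  rewrite -(gap_integral M cf pf a h0); apply: eq_integral => x _.
  by rewrite /= ger0_norm // (gap_ge0 sc).
move=> hm; rewrite EFinM muleC -lee_pdivrMl ?invr_gt0 // invrK; exact: hm.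
Qed.

(** At a kink the gap stays above some [1 / (j + 1)] for all widths, and by Markov's
    inequality the set where this happens has arbitrarily small measure. *)
Lemma ae_regular (a : R) :
  {ae mu, forall x, `[a, (a + 1)%R]%classic x -> derivable f x 1}.
Proof.
pose S (j n : nat) : set R := `[a, (a + 1)%R] `&`
   [set x | ((j.+1%:R^-1)%:E <= `|(gap (n.+1%:R^-1) x)%:E|)%E].
have mD : measurable (`[a, (a + 1)%R]%classic : set R) by exact: measurable_itv.
have mS j n : measurable (S j n).
  apply: emeasurable_fun_c_infty => //.
  by apply: measurableT_comp => //; exact: gap_measurable.
pose A j := \bigcap_n S j n.
have mA j : measurable (A j) by apply: bigcapT_measurable => n; exact: mS.
have A0 j : mu.-negligible (A j).
  apply/negligibleP; first exact: mA.
  apply/eqP; rewrite eq_le measure_ge0 andbT.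
  apply/lee_addgt0Pr => e e0; rewrite add0e.
  pose n := Num.truncn (2 * M * j.+1%:R / e).
  have hn : 2 * M * j.+1%:R / e < n.+1%:R by apply: truncnS_gt.
  apply: (@le_trans _ _ (mu (S j n))).
    apply: le_measure; [by rewrite inE; exact: mA|by rewrite inE; exact: mS|].
    by move=> x /(_ n I).
  have n0 : 0 < (n.+1%:R)^-1 :> R by rewrite invr_gt0 ltr0n.
  have j0 : 0 < (j.+1%:R)^-1 :> R by rewrite invr_gt0 ltr0n.
  apply: le_trans (gap_superlevel a n0 j0) _.
  rewrite lee_fin invrK.
  have -> : 2 * M * n.+1%:R^-1 * j.+1%:R = 2 * M * j.+1%:R / n.+1%:R :> R by ring.
  by rewrite ler_pdivrMr ?ltr0n // [e * _]mulrC -ler_pdivrMr // ltW.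
have := negligible_bigcup A0; apply: negligibleS => x /= /not_implyP[xD nd].
apply: contrapT => nA; apply: nd; apply: (regular_of_gap M0 sc) => e e0.
apply: contrapT => ng; apply: nA.
pose j := Num.truncn (e^-1).
have hj : e^-1 < j.+1%:R by apply: truncnS_gt.
exists j => // n _; split => //=.
have n0 : 0 < (n.+1%:R)^-1 :> R by rewrite invr_gt0 ltr0n.
rewrite lee_fin ger0_norm ?(gap_ge0 sc) //.
apply: (@le_trans _ _ e).
  by rewrite -[leRHS]invrK lef_pV2 ?posrE ?ltr0n ?invr_gt0 // ltW.
rewrite leNgt; apply/negP => ge; apply: ng.
by exists (n.+1%:R^-1) => //; exact: ltW.
Qed.

Lemma regular_dense (x d : R) : 0 < d -> exists y, [/\ x < y, y < x + d & derivable f y 1].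
Proof.
move=> d0; apply: contrapT => ny.
pose d' := Num.min d 1.
have d'0 : 0 < d' by rewrite /d' lt_min d0 ltr01.
have [A [mA A0 hA]] := ae_regular x.
have sub : `]x, (x + d')%R[%classic `<=` A.
  move=> y; rewrite /= in_itv /= => /andP[xy yd]; apply: hA => /= h.
  apply: ny; exists y; split => //.
    by apply: (lt_le_trans yd); rewrite lerD2l /d' ge_min lexx.
  apply: h; rewrite in_itv /= (ltW xy) /= (le_trans (ltW yd)) //.
  by rewrite lerD2l /d' ge_min lexx orbT.
have : (mu `]x, (x + d')%R[ <= mu A)%E.
  apply: le_measure => //; first by rewrite inE; exact: measurable_itv.
  by rewrite inE.
rewrite A0 lebesgue_measure_itv /= lte_fin ltrDl d'0 -EFinB lee_fin.
by rewrite addrC addKr leNgt d'0.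
Qed.

(** Only increments of [F] and [f] of width [h] are compared, so that the two functions may
    differ by a constant. *)
Lemma slope_bracket (F : R -> R) (g D e h x : R) : 0 < h ->
  (forall y, F y - F x <= g * (y - x) + M * `|y - x| * (`|y - x| + D)) ->
  (forall y, `|(F (y + h) - F y) - (f (y + h) - f y)| <= 2 * e) ->
  lower_slope M f h x - (2 * e / h + M * D) <= g <=
    upper_slope M f h x + (2 * e / h + M * D).
Proof.
move=> h0 gF Ff.
have := gF (x + h); have := gF (x - h).
have := Ff (x - h); have := Ff x.
rewrite subrK (addrC x h) addrK (addrC x (- h)) addrK normrN (gtr0_norm h0).
rewrite (addrC h x) (addrC (- h) x) !ler_norml => /andP[F1 F2] /andP[F3 F4] g1 g2.
rewrite /lower_slope /upper_slope; apply/andP; split.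
  have : (f (x + h) - f x) / h <= g + M * (h + D) + 2 * e / h.
    rewrite ler_pdivrMr //.
    have -> : (g + M * (h + D) + 2 * e / h) * h = g * h + M * h * (h + D) + 2 * e.
      by field; rewrite gt_eqF.
    by lra.
  by lra.
have : g - M * (h + D) - 2 * e / h <= (f x - f (x - h)) / h.
  rewrite ler_pdivlMr //.
  have -> : (g - M * (h + D) - 2 * e / h) * h = g * h - M * h * (h + D) - 2 * e.
    by field; rewrite gt_eqF.
  by lra.
by lra.
Qed.

(** Both [g] and the derivative of [f] are squeezed between the two slopes of [f],
    whose gap has integral [2 M h] over a period. *)
Lemma L1_dist_derive (g F : R -> R) (D e h : R) : 0 < h -> 0 <= D -> 0 <= e ->
  (forall x y, F y - F x <= g x * (y - x) + M * `|y - x| * (`|y - x| + D)) ->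
  (forall x, `|(F (x + h) - F x) - (f (x + h) - f x)| <= 2 * e) ->
  (L1_dist g (fun x => derive1 f x) <= (2 * M * h + (2 * e / h + M * D))%:E)%E.
Proof.
move=> h0 D0 e0 gF Ff; rewrite /L1_dist.
pose k := 2 * e / h + M * D.
have k0 : 0 <= k by rewrite addr_ge0 ?mulr_ge0 ?invr_ge0 // ltW.
have point x : derivable f x 1 -> `|g x - derive1 f x| <= gap h x + k.
  move=> dx; have := regular_between M0 sc dx h0 => /andP[r1 r2].
  have := slope_bracket h0 (gF x) Ff; rewrite -/k => /andP[s1 s2].
  by rewrite ler_norml; apply/andP; split; lra.
have mD : measurable (`[0, 1]%classic : set R) by exact: measurable_itv.
have gk x : 0 <= gap h x + k by rewrite addr_ge0 // (gap_ge0 sc).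
apply: (@le_trans _ _ (\int[mu]_(x in `[0%R, 1%R]) (gap h x + k)%:E)%E).
  apply: ge0_integral_le_ae => //.
  - apply/measurable_EFinP; apply: measurable_funD => //.
    by apply/measurable_EFinP; exact: gap_measurable.
  - have := ae_regular 0; rewrite add0r; apply: ae_imply => x hx x01.
    by rewrite lee_fin; apply: point; exact: hx.
under eq_integral do rewrite EFinD.
rewrite ge0_integralD //; first last.
- exact: gap_measurable.
- by move=> x _; rewrite lee_fin (gap_ge0 sc).
have := gap_integral M cf pf 0 h0; rewrite add0r => ->.
rewrite integral_cst // [X in (k%:E * X)%E](_ : _ = 1%E) ?mule1 //.
by have := lebesgue_measure_segment (@ler01 R); rewrite subr0.
Qed.

(** A kink is a downward jump of the derivative; regular points are dense, so a Lipschitz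
    [u] that agrees with the derivative there leaves no room for one. *)
Lemma lipschitz_supergradient (u : R -> R) (L : R) : 0 < L ->
  (forall x y, `|u x - u y| <= L * `|x - y|) ->
  (forall x, derivable f x 1 -> derive1 f x = u x) ->
  forall x h, 0 < h -> lower_slope M f h x <= u x <= upper_slope M f h x.
Proof.
move=> L0 uL ud x h h0.
have reg_r e : 0 < e -> exists y, [/\ x < y, y < x + e, y < x + h & derivable f y 1].
  move=> e0; have [|y [y1 y2 y3]] := @regular_dense x (Num.min e h).
    by rewrite lt_min e0 h0.
  exists y; split => //; apply: (lt_le_trans y2); rewrite lerD2l ge_min lexx ?orbT //.
have reg_l e : 0 < e -> exists y, [/\ y < x, x - e < y, x - h < y & derivable f y 1].
  move=> e0; have m0 : 0 < Num.min e h by rewrite lt_min e0 h0.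
  have [y [y1 y2 y3]] := @regular_dense (x - Num.min e h) (Num.min e h) m0.
  rewrite subrK in y2.
  exists y; split => //; apply: (le_lt_trans _ y1); rewrite lerD2l lerN2 ge_min lexx ?orbT //.
apply/andP; split; apply/ler_addgt0Pr => e e0.
  (* The slope at a regular point on the left of [x] is at least every lower slope at
     [x], up to an error that vanishes with the distance. *)
- have k0 : 0 < L + 2 * M + 1 by rewrite ltr_wpDl // addr_ge0 ?mulr_ge0 // ltW.
  have [|y [yx ye _ dy]] := reg_l (e / (L + 2 * M + 1)); first by rewrite divr_gt0.
  have d0 : 0 < x - y by rewrite subr_gt0.
  have xyh : x = y + (x - y) by ring.
  have := regular_between M0 sc dy d0 => /andP[r1 _].
  have := lower_le_upper sc x h0 d0; rewrite /upper_slope.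
  have := uL x y; rewrite (gtr0_norm d0) -(ud _ dy) ler_norml => /andP[u1 u2].
  have -> : x - (x - y) = y by ring.
  move: r1; rewrite /lower_slope -xyh.
  have : (x - y) * (L + 2 * M + 1) <= e by rewrite -ler_pdivlMr //; lra.
  by move=> b1 b2 b3; lra.
- have k0 : 0 < L + 2 * M + 1 by rewrite ltr_wpDl // addr_ge0 ?mulr_ge0 // ltW.
  have [|y [yx ye _ dy]] := reg_r (e / (L + 2 * M + 1)); first by rewrite divr_gt0.
  have d0 : 0 < y - x by rewrite subr_gt0.
  have := regular_between M0 sc dy d0 => /andP[_ r1].
  have := lower_le_upper sc x d0 h0; rewrite /lower_slope.
  have := uL y x; rewrite (gtr0_norm d0) -(ud _ dy) ler_norml => /andP[u1 u2].
  have -> : x + (y - x) = y by ring.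
  move: r1; rewrite /upper_slope.
  have -> : y - (y - x) = x by ring.
  have : (y - x) * (L + 2 * M + 1) <= e by rewrite -ler_pdivlMr //; lra.
  by move=> b1 b2 b3; lra.
Qed.

(** The chord from [x - h] to [x] gives both the upper slope at [x] and the lower slope at
    [x - h]; they differ by [2 M h], and the latter is at most [u (x - h)]. *)
Lemma lipschitz_slopes (u : R -> R) (L : R) : 0 < L ->
  (forall x y, `|u x - u y| <= L * `|x - y|) ->
  (forall x, derivable f x 1 -> derive1 f x = u x) ->
  forall x h, 0 < h ->
  u x - (L + 2 * M) * h <= lower_slope M f h x /\
  upper_slope M f h x <= u x + (L + 2 * M) * h.
Proof.
move=> L0 uL ud x h h0.
have sg := lipschitz_supergradient L0 uL ud.
have /andP[l1 _] := sg (x - h) h h0; have /andP[_ l2] := sg (x + h) h h0.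
move: l1 l2; rewrite /lower_slope /upper_slope subrK addrK => l1 l2.
have := uL (x + h) x; have := uL (x - h) x.
rewrite (addrC x h) (addrC x (- h)) !addrK normrN (gtr0_norm h0) !ler_norml.
by rewrite (addrC h) (addrC (- h)) => /andP[? ?] /andP[? ?]; split; lra.
Qed.

End regular_points.

(** * Rates at one time *)

Section assembly.
Variables (R : realType) (H : R -> R -> R -> R) (h : R -> R).
Variables (T r c0 c1 lambda0 lambda1 delta0 c : R).
Hypotheses (hH : hamiltonian H) (r_gt0 : 0 < r) (c01 : c0 <= c1)
  (hcfl : CFL_constants H h T r c0 c1 lambda1 delta0)
  (hc : c0 <= c <= c1).
Let stable := stable_mesh H r c0 c1 lambda0 lambda1 delta0.
Let lambda1_gt0 : 0 < lambda1 := cfl_lambda1_gt0 hcfl.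

Section one_time.
Variables (u0 v0 : R -> R) (v : R -> R -> R).
Hypotheses (hu0 : Linf_r0 r u0) (hv0 : primitive_of u0 v0)
  (hv : viscosity_solution H c (h c) T v0 v).
Variables (t M : R).
Hypotheses (t0T : 0 <= t <= T) (M0 : 0 <= M).
Hypothesis osl : forall N K U, stable N K -> LF_solution H c u0 N K U ->
  forall m, even_node (step_of K t) m ->
  U (step_of K t) (m + 2) - U (step_of K t) m <= 2 * mesh_dx R N * M.
Variables (beta2 delta : R).
Hypotheses (beta2_gt0 : 0 < beta2) (delta_gt0 : 0 < delta).
Hypothesis cvg_v : forall N K c u0 v0 v V, is_mesh N K ->
  lambda0 <= mesh_lambda R N K < lambda1 -> mesh_dx R N <= delta ->
  c0 <= c <= c1 -> Linf_r0 r u0 -> primitive_of u0 v0 ->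
  viscosity_solution H c (h c) T v0 v ->
  HJ_solution H c (h c) v0 N K V ->
  forall x t, 0 <= t <= T ->
    `|v_Delta N K V x t - v x t| <= beta2 * Num.sqrt (mesh_dx R N).

Let V N K := HJ_grid H c (h c) v0 N K.
Let vD N K := v_Delta N K (V N K) ^~ t.

Lemma viscosity_continuous : continuous (v ^~ t).
Proof.
move=> x.
have hA : ([set: R] `*` `[0, T]%classic) (x, t) by split; rewrite /= ?in_itv.
have /subspace_continuousP/(_ (x, t) hA) cv := visc_cont hv.
have c2 : (fun y : R => (y, t)) @ x -->
    within ([set: R] `*` `[0, T]%classic) (nbhs (x, t)).
  move=> P /= nP.
  have cp : (fun y : R => (y, t)) @ x --> (x, t).
    exact: (cvg_pair cvg_id (cvg_cst t)).
  have nP' : \forall y \near x, ([set: R] `*` `[0, T]%classic) (y, t) -> P (y, t).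
    exact: (cp _ nP).
  change (\forall y \near x, P (y, t)).
  by apply: filterS nP' => y; apply; split; rewrite /= ?in_itv.
exact: (cvg_comp _ _ c2 cv).
Qed.

Lemma viscosity_periodic : periodic1 (v ^~ t).
Proof. by move=> x; rewrite (visc_per hv). Qed.

Lemma grid_solution N K : stable N K -> HJ_solution H c (h c) v0 N K (V N K).
Proof.
move=> st; apply: HJ_grid_solution; [exact: ham_per_x|by case: hv0|].
exact: stable_is_mesh st.
Qed.

Lemma vD_le N K U : stable N K -> LF_solution H c u0 N K U -> forall x y,
  vD N K y - vD N K x <= u_Delta N K U x t * (y - x)
    + M * `|y - x| * (`|y - x| + 2 * mesh_dx R N).
Proof.
move=> st lf x y.
have [N0 K0] := is_mesh_pos (stable_is_mesh st).
have dx0 := mesh_dx_gt0 R N0.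
have lf' := HJ_slope_LF c (h c) (ham_per_x hH) hv0 (stable_is_mesh st).
pose k := step_of K t.
apply: (@interp_le R N k N0 (U k) (V N K k) M M0 _ _ x y).
  move=> m hm; rewrite (LF_unique K0 lf lf' hm) /HJ_slope.
  by rewrite mulrC divfK // gt_eqF // mulr_gt0.
exact: osl st lf.
Qed.

Lemma vD_periodic N K : stable N K -> periodic1 (vD N K).
Proof.
move=> st x; have [N0 K0] := is_mesh_pos (stable_is_mesh st).
rewrite /vD /v_Delta cell_of_period //; set k := step_of K t; set m := cell_of N k x.
have pv m' : V N K k (m' + (2 * N)%:Z) = V N K k m'.
  by apply: HJ_grid_periodic => //; [exact: ham_per_x|case: hv0].
rewrite (intDAC m _ (-1)) (intDAC m _ 1) !pv node_x_period //.
by congr (_ + _ * _); ring.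
Qed.

Lemma vD_close N K : stable N K -> mesh_dx R N <= delta ->
  forall x, `|vD N K x - v x t| <= beta2 * Num.sqrt (mesh_dx R N).
Proof.
move=> st dxd x; apply: (cvg_v _ _ _ hc hu0 hv0 hv) => //.
- exact: stable_is_mesh st.
- exact: stable_ratio st.
- exact: grid_solution.
Qed.

(** The viscosity solution inherits the one-sided bound as the limit of the
    interpolants along refinements of one admissible mesh. *)
Lemma viscosity_semiconcave N K : stable N K -> semiconcave M (v ^~ t).
Proof.
move=> st x y z xy yz; apply/ler_addgt0Pr => e e0.
have [N0 K0] := is_mesh_pos (stable_is_mesh st).
have dx0 := mesh_dx_gt0 R N0.
set q := z - y; set p := y - x.
have q0 : 0 < q by rewrite subr_gt0.
have p0 : 0 < p by rewrite subr_gt0.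
pose kc := 4 * M + 2 * beta2 / q + 2 * beta2 / p + 1.
have kc0 : 0 < kc.
  by rewrite /kc ltr_wpDl // !addr_ge0 ?divr_ge0 ?mulr_ge0 // ltW.
pose eta := Num.min delta ((e / kc) ^+ 2).
have eta0 : 0 < eta by rewrite /eta lt_min delta_gt0 exprn_gt0 // divr_gt0.
pose j := (Num.truncn (eta^-1)).+1.
have j0 : (0 < j)%N by [].
have hj : mesh_dx R (j * N) <= eta.
  have hj1 : eta^-1 < j%:R by apply: truncnS_gt.
  rewrite /mesh_dx -[leRHS]invrK lef_pV2 ?posrE ?invr_gt0 ?ltr0n ?muln_gt0 ?j0 //.
  apply: (le_trans (ltW hj1)); rewrite ler_nat mulnCA leq_pmulr // muln_gt0 //.
have st' := stable_mesh_refine hH lambda1_gt0 c01 j0 st.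
set N' := (j * N)%N in hj st'; set K' := (j * K)%N in st'.
have [N0' K0'] := is_mesh_pos (stable_is_mesh st').
have dx0' := mesh_dx_gt0 R N0'.
have lf' := HJ_slope_LF c (h c) (ham_per_x hH) hv0 (stable_is_mesh st').
have hjd : mesh_dx R N' <= delta by apply: (le_trans hj); rewrite /eta ge_min lexx.
have close := vD_close st' hjd.
set s := Num.sqrt (mesh_dx R N') in close.
have s0 : 0 <= s by exact: sqrtr_ge0.
have ss : mesh_dx R N' = s * s by rewrite -expr2 sqr_sqrtr // ltW.
have s1 : s <= 1.
  by rewrite -[leRHS]sqrtr1 ler_sqrt // mesh_dx_le1.
have ske : s * kc <= e.
  rewrite -ler_pdivlMr // -(ler_pXn2r (n := 2)) ?nnegrE ?divr_ge0 ?(ltW e0) ?(ltW kc0) //.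
  by rewrite expr2 -ss (le_trans hj) // /eta ge_min lexx orbT.
have dxs : mesh_dx R N' <= s by rewrite ss ler_piMl.
have := vD_le st' lf' y z; have := vD_le st' lf' y x.
have Cx := close x; have Cy := close y; have Cz := close z.
set U := u_Delta _ _ _ _ _; set dx := mesh_dx R N' in ss dxs *.
rewrite -/q (gtr0_norm q0) distrC -/p (gtr0_norm p0) -[x - y]opprB -/p => h1 h2.
move: Cx Cy Cz; rewrite !ler_norml => /andP[Cx1 Cx2] /andP[Cy1 Cy2] /andP[Cz1 Cz2].
have a1 : (v z t - v y t) / q <= U + M * (q + 2 * dx) + 2 * beta2 / q * s.
  rewrite ler_pdivrMr //.
  have -> : (U + M * (q + 2 * dx) + 2 * beta2 / q * s) * q =
    U * q + M * q * (q + 2 * dx) + 2 * beta2 * s by field; rewrite gt_eqF.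
  by lra.
have a2 : U - M * (p + 2 * dx) - 2 * beta2 / p * s <= (v y t - v x t) / p.
  rewrite ler_pdivlMr //.
  have -> : (U - M * (p + 2 * dx) - 2 * beta2 / p * s) * p =
    U * p - M * p * (p + 2 * dx) - 2 * beta2 * s by field; rewrite gt_eqF.
  by lra.
have a3 : M * dx <= M * s by rewrite ler_wpM2l.
have -> : z - x = q + p by rewrite /q /p; ring.
have : s * kc = 4 * (M * s) + 2 * beta2 / q * s + 2 * beta2 / p * s + s by rewrite /kc; ring.
by lra.
Qed.

(** The width [w] of the difference quotients and the error [e]: [w = dx^(1/4)] balances
    [w] against the distance [sqrt dx] of the primitives. On meshes too coarse for the
    convergence estimate the width is [1], and periodicity makes all increments vanish. *)
Lemma scale_choice N K : stable N K -> exists w e,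
  [/\ 0 < w, 0 <= e,
    forall x, `|(vD N K (x + w) - vD N K x) - (v (x + w) t - v x t)| <= 2 * e,
    w <= (1 + (delta `^ (1 / 4))^-1) * mesh_dx R N `^ (1 / 4)
  & 2 * e / w <= 2 * beta2 * mesh_dx R N `^ (1 / 4)].
Proof.
move=> st; have [N0 K0] := is_mesh_pos (stable_is_mesh st).
have [] := quarter_power R N0; set q := _ `^ _ => q0 sq dxq.
have d0 : 0 < delta `^ (1 / 4) by exact: powR_gt0.
have di0 : 0 < (delta `^ (1 / 4))^-1 by rewrite invr_gt0.
have [dxd|dxd] := leP (mesh_dx R N) delta.
  exists q, (beta2 * (q * q)); split => //.
  - by rewrite !mulr_ge0 // ltW.
  - move=> x; have := vD_close st dxd x; have := vD_close st dxd (x + q).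
    by rewrite sq !ler_norml => /andP[? ?] /andP[? ?]; apply/andP; split; lra.
  - by rewrite mulrDl mul1r lerDl mulr_ge0 // ltW.
  - have -> : 2 * (beta2 * (q * q)) / q = 2 * beta2 * q by field; rewrite gt_eqF.
    by [].
exists 1, 0; split => //.
- by move=> x; rewrite (vD_periodic st) viscosity_periodic !subrr normr0 mulr0.
- rewrite mulrDl mul1r.
  have : delta `^ (1 / 4) <= q.
    by rewrite ge0_ler_powR ?nnegrE ?(ltW delta_gt0) ?(ltW dxd) ?divr_ge0 ?(ltW (mesh_dx_gt0 _ _)).
  rewrite -(ler_pM2l di0) mulVf ?gt_eqF //; lra.
- by rewrite mulr0 mul0r !mulr_ge0 // ltW.
Qed.

Definition rate := 2 * M * (1 + (delta `^ (1 / 4))^-1) + 2 * beta2 + 2 * M.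

Lemma L1_rate N K U : stable N K -> LF_solution H c u0 N K U ->
  (L1_dist (u_Delta N K U ^~ t) (v_x v ^~ t) <= (rate * mesh_dx R N `^ (1 / 4))%:E)%E.
Proof.
move=> st lf; have [N0 K0] := is_mesh_pos (stable_is_mesh st).
have dx0 := mesh_dx_gt0 R N0.
have [w [e [w0 e0 close wq eq]]] := scale_choice st.
have [] := quarter_power R N0; set q := _ `^ _ in wq eq * => q0 _ dxq.
have D0 : 0 <= 2 * mesh_dx R N by rewrite mulr_ge0 // ltW.
have := L1_dist_derive M0 (viscosity_semiconcave st) viscosity_continuous
  viscosity_periodic w0 D0 e0 (vD_le st lf) close.
move/le_trans; apply; rewrite lee_fin /rate -/q.
have := ler_wpM2l M0 wq; have := ler_wpM2l M0 dxq.
by rewrite mulrA; lra.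
Qed.

Definition sup_rate L := (L + 2 * M) * (1 + (delta `^ (1 / 4))^-1) + 2 * beta2 + 2 * M.

Lemma sup_rate_bound (L : R) N K U : 0 < L ->
  (forall x y, `|v_x v x t - v_x v y t| <= L * `|x - y|) ->
  stable N K -> LF_solution H c u0 N K U -> forall x,
  `|u_Delta N K U x t - v_x v x t| <= sup_rate L * mesh_dx R N `^ (1 / 4).
Proof.
move=> L0 uL st lf x; have [N0 K0] := is_mesh_pos (stable_is_mesh st).
have [w [e [w0 e0 close wq eq]]] := scale_choice st.
have [] := quarter_power R N0; set q := _ `^ _ in wq eq * => q0 _ dxq.
have scv := viscosity_semiconcave st.
have /andP[s1 s2] := slope_bracket w0 (vD_le st lf x) close.
have [l1 l2] := lipschitz_slopes M0 scv viscosity_continuous viscosity_periodic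
  L0 uL (fun x _ => erefl) x w0.
have LM : 0 <= L + 2 * M by rewrite addr_ge0 ?mulr_ge0 // ltW.
have := ler_wpM2l LM wq; have := ler_wpM2l M0 dxq; rewrite /sup_rate mulrA.
by rewrite ler_norml => k1 k2; apply/andP; split; lra.
Qed.

End one_time.
End assembly.

(** * The theorem *)

Unset Implicit Arguments.

Theorem theorem4p1 (R : realType) (H : R -> R -> R -> R) (h : R -> R)
    (T r c0 c1 lambda0 lambda1 delta0 c : R)
    (hH : hamiltonian H) (hh : continuous h)
    (hT : 0 < T) (hr : 0 < r) (hc01 : c0 <= c1)
    (hlambda1 : CFL_constants H h T r c0 c1 lambda1 delta0)
    (hlambda0 : 0 < lambda0) (hc : c0 <= c <= c1) :
  [/\ forall t, 0 < t <= T ->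
        exists2 beta4 : R, 0 < beta4 &
          forall (u0 : R -> R) (u : R -> R -> R) (N K : nat)
                 (U : nat -> int -> R),
            Linf_r0 r u0 -> entropy_solution H c (h c) T u0 u ->
            mesh_conditions H r c0 c1 lambda0 lambda1 delta0 N K ->
            LF_solution H c u0 N K U ->
            (L1_dist (u_Delta N K U ^~ t) (u ^~ t)
               <= (beta4 * mesh_dx R N `^ (1 / 4))%:E)%E,
      forall (u0 : R -> R) (u : R -> R -> R),
        Linf_r0 r u0 -> entropy_solution H c (h c) T u0 u ->
        rarefaction_free u0 ->
        exists2 beta5 : R, 0 < beta5 &
          forall (N K : nat) (U : nat -> int -> R),
            mesh_conditions H r c0 c1 lambda0 lambda1 delta0 N K ->
            LF_solution H c u0 N K U ->
            forall t, 0 <= t <= T ->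
              (L1_dist (u_Delta N K U ^~ t) (u ^~ t)
                 <= (beta5 * mesh_dx R N `^ (1 / 4))%:E)%E
    & forall (u0 : R -> R) (u : R -> R -> R),
        Linf_r0 r u0 -> entropy_solution H c (h c) T u0 u ->
        lipschitz_sol T u ->
        exists2 beta6 : R, 0 < beta6 &
          forall (N K : nat) (U : nat -> int -> R),
            mesh_conditions H r c0 c1 lambda0 lambda1 delta0 N K ->
            LF_solution H c u0 N K U ->
            forall x t, 0 <= t <= T ->
              `|u_Delta N K U x t - u x t|
                <= beta6 * mesh_dx R N `^ (1 / 4) ].
Proof.
have lambda1_gt0 := cfl_lambda1_gt0 hlambda1.
have A0 := Hxx_star_ge0 hH lambda1_gt0 hc01.
have B0 := Hxp_star_ge0 hH lambda1_gt0 hc01.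
have C0 := Hpp_star_gt0 hH lambda1_gt0 hc01.
have [es0 _ _] := E_star_stationary A0 B0 C0.
set es := _ + Num.sqrt _ in es0.
have esE : es = E_star H c0 c1 lambda1 by [].
have [beta2 [delta [beta2_gt0 delta_gt0 cvg_v]]] := cfl_cvg_v hlambda1 hlambda0.
have rate_gt0 M : 0 <= M -> 0 < rate M beta2 delta.
  move=> M0; have d0 : 0 < delta `^ (1 / 4) by exact: powR_gt0.
  rewrite /rate ltr_wpDr ?mulr_ge0 // ltr_wpDl ?mulr_gt0 //.
  by rewrite !mulr_ge0 // addr_ge0 // invr_ge0 ltW.
have sup_rate_gt0 M L : 0 <= M -> 0 < L -> 0 < sup_rate M beta2 delta L.
  move=> M0 L0; have d0 : 0 < delta `^ (1 / 4) by exact: powR_gt0.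
  rewrite /sup_rate ltr_wpDr ?mulr_ge0 // ltr_wpDl ?mulr_gt0 //.
  by rewrite mulr_ge0 // addr_ge0 ?mulr_ge0 ?invr_ge0 // ltW.
split.
- move=> t t0T; have /andP[t0 tT] := t0T.
  have M0 : 0 <= es + 2 / (Hpp_star H c0 c1 lambda1 * t).
    by rewrite addr_ge0 // divr_ge0 // mulr_ge0 // ltW.
  exists (rate (es + 2 / (Hpp_star H c0 c1 lambda1 * t)) beta2 delta).
    exact: rate_gt0.
  move=> u0 u N K U hu0 [v0 [v [hv0 hv ->]]] mc lf.
  have st := mesh_conditions_stable hH lambda1_gt0 hc01 hr mc.
  have t0T' : 0 <= t <= T by rewrite (ltW t0).
  apply: (L1_rate hH hc01 hlambda1 hc hu0 hv0 hv t0T' M0 _ beta2_gt0 delta_gt0 cvg_v st lf).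
  move=> N' K' U' st' lf' m hm.
  exact: (LF_osl_decay hH hr hc01 hlambda1 hc hu0 st' lf' t0T hm).
- move=> u0 u hu0 [v0 [v [hv0 hv ->]]] /rarefaction_free_osl[m0 m00 osl].
  have M0 : 0 <= es + 2 * m0 by rewrite addr_ge0 // mulr_ge0.
  exists (rate (es + 2 * m0) beta2 delta); first exact: rate_gt0.
  move=> N K U mc lf t t0T.
  have st := mesh_conditions_stable hH lambda1_gt0 hc01 hr mc.
  apply: (L1_rate hH hc01 hlambda1 hc hu0 hv0 hv t0T M0 _ beta2_gt0 delta_gt0 cvg_v st lf).
  move=> N' K' U' st' lf' m hm.
  exact: (LF_osl_uniform hH hr hc01 hlambda1 hc hu0 st' lf' m00 osl t0T hm).
- move=> u0 u hu0 [v0 [v [hv0 hv ->]]] lip.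
  have [m0 m00 osl] := lipschitz_osl (ltW hT) hu0 hv0 (visc_init hv) lip.
  have [L L0 hL] := lipschitz_solP lip.
  have M0 : 0 <= es + 2 * m0 by rewrite addr_ge0 // mulr_ge0.
  exists (sup_rate (es + 2 * m0) beta2 delta L); first exact: sup_rate_gt0.
  move=> N K U mc lf x t t0T.
  have st := mesh_conditions_stable hH lambda1_gt0 hc01 hr mc.
  have uL y z : `|v_x v y t - v_x v z t| <= L * `|y - z| by exact: hL.
  apply: (sup_rate_bound hH hc01 hlambda1 hc hu0 hv0 hv t0T M0 _ beta2_gt0 delta_gt0 cvg_v L0 uL st lf).
  move=> N' K' U' st' lf' m hm.
  exact: (LF_osl_uniform hH hr hc01 hlambda1 hc hu0 st' lf' m00 osl t0T hm).
Qed.
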